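(* Let $d\geq 2$. Then the Green algebra $R(H_{n,d})$ has exactly $nd-n+m$ irreducible modules (up to isomorphism), and each irreducible module is $1$-dimensional over $\mathbb{C}$.
   Context: Let $K$ be an algebraically closed field of characteristic $0$, let $n,d\geq 2$ be integers with $d\mid n$, put $m=n/d$, and let $q\in K$ be a primitive $d$-th root of unity. The generalized Taft algebra $H_{n,d}=H_{n,d}(q)$ is the $K$-algebra generated by $g,h$ subject to $g^n=1$, $h^d=0$, $hg=qgh$; it is a Hopf algebra of dimension $nd$ with $\Delta(g)=g\otimes g$, $\Delta(h)=1\otimes h+h\otimes g$, $\varepsilon(g)=1$, $\varepsilon(h)=0$, $S(g)=g^{-1}$, $S(h)=-q^{-1}g^{n-1}h$. Modules are finite dimensional left modules; tensor products of $H_{n,d}$-modules are over $K$ with action through $\Delta$. The Green ring $r(H)$ of a Hopf algebra $H$ is the abelian group generated by isomorphism classes $[V]$ of finite dimensional $H$-modules modulo $[V\oplus W]=[V]+[W]$, with multiplication $[V][W]=[V\otimes W]$. The Green algebra is the $\mathbb{C}$-algebra $R(H)=\mathbb{C}\otimes_{\mathbb{Z}}r(H)$. *)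

(* Defs.v *)
From HB Require Import structures.
From mathcomp Require Import all_boot all_order all_algebra.
From mathcomp Require Import ring boolp reals mxtens complex.

Set Implicit Arguments.
Unset Strict Implicit.
Unset Printing Implicit Defensive.

Import GRing.Theory.
Local Open Scope ring_scope.
Local Open Scope quotient_scope.

Section PropQuotient.
Variables (T : Type) (E : T -> T -> Prop).
Hypotheses (Erefl : forall x, E x x) (Esym : forall x y, E x y -> E y x).
Hypothesis Etrans : forall x y z, E x y -> E y z -> E x z.

Definition pquo_rel : rel {classic T} := fun x y => `[< E x y >].

Lemma pquo_rel_equiv : equiv_class_of pquo_rel.
Proof.
split=> [x|x y|y x z]; rewrite /pquo_rel.
- by apply/asboolP.
- by apply/asboolP/asboolP; apply: Esym.
- by move=> /asboolP xy /asboolP yz; apply/asboolP; apply: Etrans xy yz.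
Qed.

Definition pquo_equiv : equiv_rel {classic T} := EquivRelPack pquo_rel_equiv.

Definition pquo := {eq_quot pquo_equiv}.
HB.instance Definition _ := Choice.on pquo.

Definition pcls (x : T) : pquo := \pi_{eq_quot pquo_equiv} (x : {classic T}).
Definition prep (x : pquo) : T := repr (x : {eq_quot pquo_equiv}).

Lemma prepK : cancel prep pcls.
Proof. exact: reprK. Qed.

Lemma pclsE x y : pcls x = pcls y <-> E x y.
Proof.
by split=> [/eqmodP/asboolP //|xy]; apply/eqmodP/asboolP.
Qed.

Lemma pcls_rep x : E (prep (pcls x)) x.
Proof. by apply/pclsE; rewrite prepK. Qed.

Lemma pquoW (P : pquo -> Prop) : (forall t, P (pcls t)) -> forall x, P x.
Proof. by move=> Pt x; rewrite -(prepK x). Qed.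
End PropQuotient.

Inductive zterm (X : Type) :=
  ZGen of X | ZZero | ZAdd of zterm X & zterm X | ZOpp of zterm X.
Arguments ZZero {X}.

(* [zpres rel] is the free abelian group on [X] modulo the subgroup generated *)
(* by the differences [s - t] for [rel s t], realized as formal expressions   *)
(* modulo the smallest congruence [zcongr rel] containing [rel] and the       *)
(* abelian group axioms; [zlift] is its universal property.                   *)
Section ZPresentation.
Variables (X : Type) (rel : zterm X -> zterm X -> Prop).

Inductive zcongr : zterm X -> zterm X -> Prop :=
| zc_rel s t : rel s t -> zcongr s t
| zc_refl s : zcongr s s
| zc_sym s t : zcongr s t -> zcongr t s
| zc_trans s t u : zcongr s t -> zcongr t u -> zcongr s u
| zc_add s s' t t' : zcongr s s' -> zcongr t t' -> zcongr (ZAdd s t) (ZAdd s' t')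
| zc_opp s s' : zcongr s s' -> zcongr (ZOpp s) (ZOpp s')
| zc_addA s t u : zcongr (ZAdd s (ZAdd t u)) (ZAdd (ZAdd s t) u)
| zc_addC s t : zcongr (ZAdd s t) (ZAdd t s)
| zc_add0 s : zcongr (ZAdd ZZero s) s
| zc_addN s : zcongr (ZAdd (ZOpp s) s) ZZero.

Definition zpres := pquo zc_refl zc_sym zc_trans.
HB.instance Definition _ := Choice.on zpres.

Definition zcls (t : zterm X) : zpres := pcls zc_refl zc_sym zc_trans t.
Definition zrep (x : zpres) : zterm X := prep x.

Lemma zclsE s t : zcls s = zcls t <-> zcongr s t.
Proof. exact: pclsE. Qed.

Lemma zpresW (P : zpres -> Prop) : (forall t, P (zcls t)) -> forall x, P x.
Proof. exact: pquoW. Qed.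

Lemma zcls_rep t : zcongr (zrep (zcls t)) t.
Proof. exact: pcls_rep. Qed.

Definition zp_add (x y : zpres) := zcls (ZAdd (zrep x) (zrep y)).
Definition zp_opp (x : zpres) := zcls (ZOpp (zrep x)).

Lemma zclsD s t : zcls (ZAdd s t) = zp_add (zcls s) (zcls t).
Proof. by apply/zclsE/zc_sym/zc_add; apply: zcls_rep. Qed.

Lemma zclsN s : zcls (ZOpp s) = zp_opp (zcls s).
Proof. by apply/zclsE/zc_sym/zc_opp/zcls_rep. Qed.

Lemma zp_addA : associative zp_add.
Proof.
elim/zpresW=> s; elim/zpresW=> t; elim/zpresW=> u; rewrite -!zclsD.
exact/zclsE/zc_addA.
Qed.

Lemma zp_addC : commutative zp_add.
Proof. elim/zpresW=> s; elim/zpresW=> t; rewrite -!zclsD; exact/zclsE/zc_addC. Qed.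

Lemma zp_add0 : left_id (zcls ZZero) zp_add.
Proof. elim/zpresW=> s; rewrite -zclsD; exact/zclsE/zc_add0. Qed.

Lemma zp_addN : left_inverse (zcls ZZero) zp_opp zp_add.
Proof. elim/zpresW=> s; rewrite -zclsN -zclsD; exact/zclsE/zc_addN. Qed.

HB.instance Definition _ :=
  GRing.isZmodule.Build zpres zp_addA zp_addC zp_add0 zp_addN.

Definition zgen (a : X) : zpres := zcls (ZGen a).

Lemma zpres_ind (P : zpres -> Prop) :
    (forall a, P (zgen a)) -> P 0 -> (forall x y, P x -> P y -> P (x + y)) ->
    (forall x, P x -> P (- x)) -> forall x, P x.
Proof.
move=> Pg P0 PD PN; elim/zpresW; elim=> [a||s Ps t Pt|s Ps].
- exact: Pg.
- exact: P0.
- by rewrite zclsD; apply: PD.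
- by rewrite zclsN; apply: PN.
Qed.

Section Lift.
Variables (V : zmodType) (f : X -> V).

Fixpoint zeval (t : zterm X) : V :=
  match t with
  | ZGen a => f a
  | ZZero => 0
  | ZAdd s t => zeval s + zeval t
  | ZOpp s => - zeval s
  end.

Hypothesis f_rel : forall s t, rel s t -> zeval s = zeval t.

Lemma zeval_congr s t : zcongr s t -> zeval s = zeval t.
Proof.
elim=> //= {s t}.
- by move=> s t u _ -> _ ->.
- by move=> s s' t t' _ -> _ ->.
- by move=> s s' _ ->.
- by move=> s t u; rewrite addrA.
- by move=> s t; rewrite addrC.
- by move=> s; rewrite add0r.
- by move=> s; rewrite addNr.
Qed.

Definition zlift (x : zpres) : V := zeval (zrep x).

Lemma zlift_cls t : zlift (zcls t) = zeval t.
Proof. exact/zeval_congr/zcls_rep. Qed.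

Lemma zlift_gen a : zlift (zgen a) = f a.
Proof. exact: zlift_cls. Qed.

Lemma zlift_is_additive : zmod_morphism zlift.
Proof.
elim/zpresW=> s; elim/zpresW=> t.
have -> : zcls s - zcls t = zcls (ZAdd s (ZOpp t)) by rewrite zclsD zclsN.
by rewrite !zlift_cls.
Qed.
End Lift.

Lemma zpres_hom_eq (V : zmodType) (f g : zpres -> V) :
    zmod_morphism f -> zmod_morphism g ->
    (forall a, f (zgen a) = g (zgen a)) -> f =1 g.
Proof.
move=> fB gB fg.
have f0 : f 0 = 0 by have := fB 0 0; rewrite !subrr.
have g0 : g 0 = 0 by have := gB 0 0; rewrite !subrr.
have fN x : f (- x) = - f x by rewrite -[- x]sub0r fB f0 sub0r.
have gN x : g (- x) = - g x by rewrite -[- x]sub0r gB g0 sub0r.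
elim/zpres_ind=> [//||x y fx fy|x fx]; first by rewrite f0 g0.
- by rewrite -[y]opprK fB gB fx !fN !gN fy.
- by rewrite fN gN fx.
Qed.
End ZPresentation.
Arguments zgen {X} rel a.


Section ZBilinearLift.
Variables (X Y : Type) (relX : zterm X -> zterm X -> Prop).
Variables (relY : zterm Y -> zterm Y -> Prop) (V : zmodType) (f : X -> Y -> V).
Hypothesis f_relr : forall a s t, relY s t -> zeval (f a) s = zeval (f a) t.
Hypothesis f_rell : forall b s t, relX s t -> zeval (f^~ b) s = zeval (f^~ b) t.

Definition zlift2 (x : zpres relX) (y : zpres relY) : V :=
  zlift (fun a => zlift (f a) y) x.

Lemma zeval_ext (Z : Type) (g h : Z -> V) : g =1 h -> zeval g =1 zeval h.
Proof. by move=> gh; elim=> [a||s /= -> t ->|s /= ->] //=. Qed.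

Lemma zeval_exchange s t :
  zeval (fun a => zeval (f a) t) s = zeval (fun b => zeval (f^~ b) s) t.
Proof.
elim: s => [a||s IHs s' IHs'|s IHs] /=.
- exact: zeval_ext.
- by elim: t => [b||t IHt t' IHt'|t IHt] //=; rewrite -?IHt -?IHt' ?addr0 ?oppr0.
- rewrite {}IHs {}IHs'; elim: t => [b||t IHt t' IHt'|t IHt] //=.
  + by rewrite addr0.
  + by rewrite -IHt -IHt' addrACA.
  + by rewrite -IHt opprD.
- rewrite {}IHs; elim: t => [b||t IHt t' IHt'|t IHt] //=.
  + by rewrite oppr0.
  + by rewrite -IHt -IHt' opprD.
  + by rewrite -IHt.
Qed.

Lemma zlift2_rel (y : zpres relY) s t : relX s t ->
  zeval (fun a => zlift (f a) y) s = zeval (fun a => zlift (f a) y) t.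
Proof.
move=> st; rewrite /zlift !zeval_exchange.
by apply: zeval_ext => b; apply: f_rell.
Qed.

Lemma zlift2_gen a b : zlift2 (zgen relX a) (zgen relY b) = f a b.
Proof.
by rewrite /zlift2 (zlift_gen (@zlift2_rel _)) zlift_gen //; apply: f_relr.
Qed.

Lemma zlift2Bl y : zmod_morphism (zlift2^~ y).
Proof. exact: zlift_is_additive (@zlift2_rel y). Qed.

Lemma zlift2Br x : zmod_morphism (zlift2 x).
Proof.
move=> y z.
apply: (@zpres_hom_eq X relX V (zlift2^~ (y - z))
          (fun x => zlift2 x y - zlift2 x z)) => [|u v|a].
- exact: zlift2Bl.
- by rewrite !zlift2Bl !opprD !opprK addrACA.
- rewrite /zlift2 !(zlift_gen (@zlift2_rel _)).
  exact: (zlift_is_additive (f_relr a)).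
Qed.
End ZBilinearLift.

Section ZModMorphism.
Variables (U V : zmodType) (f : U -> V).
Hypothesis fB : zmod_morphism f.

Lemma zmm0 : f 0 = 0.
Proof. by have := fB 0 0; rewrite !subrr. Qed.

Lemma zmmN x : f (- x) = - f x.
Proof. by rewrite -[- x]sub0r fB zmm0 sub0r. Qed.

Lemma zmmD x y : f (x + y) = f x + f y.
Proof. by rewrite -[y]opprK fB (zmmN (- y)). Qed.
End ZModMorphism.

Inductive aterm (k X : Type) :=
| AGen of X
| AScal of k
| AAdd of aterm k X & aterm k X
| AMul of aterm k X & aterm k X.

(* [apres rel] is the free associative unital [k]-algebra on [X] modulo the   *)
(* two-sided ideal generated by the [s - t] for [rel s t], realized likewise. *)
Section AlgebraPresentation.
Variables (k : comNzRingType) (X : Type).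
Variable rel : aterm k X -> aterm k X -> Prop.

Inductive acongr : aterm k X -> aterm k X -> Prop :=
| ac_rel s t : rel s t -> acongr s t
| ac_refl s : acongr s s
| ac_sym s t : acongr s t -> acongr t s
| ac_trans s t u : acongr s t -> acongr t u -> acongr s u
| ac_add s s' t t' : acongr s s' -> acongr t t' -> acongr (AAdd s t) (AAdd s' t')
| ac_mul s s' t t' : acongr s s' -> acongr t t' -> acongr (AMul s t) (AMul s' t')
| ac_addA s t u : acongr (AAdd s (AAdd t u)) (AAdd (AAdd s t) u)
| ac_addC s t : acongr (AAdd s t) (AAdd t s)
| ac_add0 s : acongr (AAdd (AScal X 0) s) s
| ac_addN s : acongr (AAdd (AMul (AScal X (-1)) s) s) (AScal X 0)
| ac_mulA s t u : acongr (AMul s (AMul t u)) (AMul (AMul s t) u)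
| ac_mul1l s : acongr (AMul (AScal X 1) s) s
| ac_mul1r s : acongr (AMul s (AScal X 1)) s
| ac_mulDl s t u : acongr (AMul (AAdd s t) u) (AAdd (AMul s u) (AMul t u))
| ac_mulDr s t u : acongr (AMul s (AAdd t u)) (AAdd (AMul s t) (AMul s u))
| ac_scalD a b : acongr (AScal X (a + b)) (AAdd (AScal X a) (AScal X b))
| ac_scalM a b : acongr (AScal X (a * b)) (AMul (AScal X a) (AScal X b))
| ac_scalC a s : acongr (AMul s (AScal X a)) (AMul (AScal X a) s).

Definition apres := pquo ac_refl ac_sym ac_trans.
HB.instance Definition _ := Choice.on apres.

Definition acls (t : aterm k X) : apres := pcls ac_refl ac_sym ac_trans t.
Definition arep (x : apres) : aterm k X := prep x.

Lemma aclsE s t : acls s = acls t <-> acongr s t.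
Proof. exact: pclsE. Qed.

Lemma apresW (P : apres -> Prop) : (forall t, P (acls t)) -> forall x, P x.
Proof. exact: pquoW. Qed.

Lemma acls_rep t : acongr (arep (acls t)) t.
Proof. exact: pcls_rep. Qed.

Definition ap_add (x y : apres) := acls (AAdd (arep x) (arep y)).
Definition ap_mul (x y : apres) := acls (AMul (arep x) (arep y)).
Definition ap_scal (c : k) : apres := acls (AScal X c).

Lemma aclsD s t : acls (AAdd s t) = ap_add (acls s) (acls t).
Proof. by apply/aclsE/ac_sym/ac_add; apply: acls_rep. Qed.

Lemma aclsM s t : acls (AMul s t) = ap_mul (acls s) (acls t).
Proof. by apply/aclsE/ac_sym/ac_mul; apply: acls_rep. Qed.

Definition ap_opp (x : apres) := ap_mul (ap_scal (-1)) x.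

Lemma ap_addA : associative ap_add.
Proof.
elim/apresW=> s; elim/apresW=> t; elim/apresW=> u; rewrite -!aclsD.
exact/aclsE/ac_addA.
Qed.

Lemma ap_addC : commutative ap_add.
Proof. elim/apresW=> s; elim/apresW=> t; rewrite -!aclsD; exact/aclsE/ac_addC. Qed.

Lemma ap_add0 : left_id (ap_scal 0) ap_add.
Proof. elim/apresW=> s; rewrite /ap_scal -aclsD; exact/aclsE/ac_add0. Qed.

Lemma ap_addN : left_inverse (ap_scal 0) ap_opp ap_add.
Proof. elim/apresW=> s; rewrite /ap_opp /ap_scal -aclsM -aclsD.
exact/aclsE/ac_addN. Qed.

HB.instance Definition _ :=
  GRing.isZmodule.Build apres ap_addA ap_addC ap_add0 ap_addN.

Lemma ap_mulA : associative ap_mul.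
Proof.
elim/apresW=> s; elim/apresW=> t; elim/apresW=> u; rewrite -!aclsM.
exact/aclsE/ac_mulA.
Qed.

Lemma ap_mul1l : left_id (ap_scal 1) ap_mul.
Proof. elim/apresW=> s; rewrite /ap_scal -aclsM; exact/aclsE/ac_mul1l. Qed.

Lemma ap_mul1r : right_id (ap_scal 1) ap_mul.
Proof. elim/apresW=> s; rewrite /ap_scal -aclsM; exact/aclsE/ac_mul1r. Qed.

Lemma ap_mulDl : left_distributive ap_mul +%R.
Proof.
elim/apresW=> s; elim/apresW=> t; elim/apresW=> u.
rewrite -[acls s + acls t]aclsD -!aclsM -[RHS]aclsD; exact/aclsE/ac_mulDl.
Qed.

Lemma ap_mulDr : right_distributive ap_mul +%R.
Proof.
elim/apresW=> s; elim/apresW=> t; elim/apresW=> u.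
rewrite -[acls t + acls u]aclsD -!aclsM -[RHS]aclsD; exact/aclsE/ac_mulDr.
Qed.

HB.instance Definition _ :=
  GRing.Zmodule_isPzRing.Build apres ap_mulA ap_mul1l ap_mul1r ap_mulDl ap_mulDr.

Definition agen (a : X) : apres := acls (AGen k a).

Lemma ap_scalD a b : ap_scal (a + b) = ap_scal a + ap_scal b.
Proof. rewrite -[RHS]aclsD; exact/aclsE/ac_scalD. Qed.

Lemma ap_scalM a b : ap_scal (a * b) = ap_scal a * ap_scal b.
Proof. rewrite -[RHS]aclsM; exact/aclsE/ac_scalM. Qed.

Lemma ap_scalC a x : x * ap_scal a = ap_scal a * x.
Proof.
elim/apresW: x => s; rewrite -[LHS]aclsM -[RHS]aclsM; exact/aclsE/ac_scalC.
Qed.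

Definition ap_scale (c : k) (x : apres) : apres := ap_scal c * x.

Lemma ap_scaleA a b x : ap_scale a (ap_scale b x) = ap_scale (a * b) x.
Proof. by rewrite /ap_scale ap_scalM mulrA. Qed.

Lemma ap_scale1 : left_id 1 ap_scale.
Proof. by move=> x; rewrite /ap_scale mul1r. Qed.

Lemma ap_scaleDr : right_distributive ap_scale +%R.
Proof. by move=> a x y; rewrite /ap_scale mulrDr. Qed.

Lemma ap_scaleDl x : {morph ap_scale^~ x : a b / a + b}.
Proof. by move=> a b; rewrite /ap_scale ap_scalD mulrDl. Qed.

HB.instance Definition _ :=
  GRing.Zmodule_isLmodule.Build k apres ap_scaleA ap_scale1 ap_scaleDr ap_scaleDl.

Lemma ap_scalerAl (c : k) (x y : apres) : c *: (x * y) = (c *: x) * y.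
Proof. exact: mulrA. Qed.

Lemma ap_scalerAr (c : k) (x y : apres) : c *: (x * y) = x * (c *: y).
Proof.
by rewrite -[c *: (x * y)]/(ap_scal c * _) mulrA -ap_scalC -mulrA.
Qed.

Lemma apres_ind (P : apres -> Prop) :
    (forall a, P (agen a)) -> (forall c : k, P (c *: (1 : apres))) ->
    (forall x y, P x -> P y -> P (x + y)) ->
    (forall x y, P x -> P y -> P (x * y)) -> forall x, P x.
Proof.
move=> Pg Pc PD PM; elim/apresW; elim=> [a|c|s Ps t Pt|s Ps t Pt].
- exact: Pg.
- have -> : acls (AScal X c) = c *: (1 : apres) by rewrite -[RHS]/(ap_scal c * 1) mulr1.
  exact: Pc.
- by rewrite aclsD; apply: PD.
- by rewrite aclsM; apply: PM.
Qed.

(* [phi] is the structure map of the [k]-algebra [B], with central image. *)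
Section Lift.
Variables (B : pzRingType) (phi : {rmorphism k -> B}) (f : X -> B).

Fixpoint aeval (t : aterm k X) : B :=
  match t with
  | AGen a => f a
  | AScal c => phi c
  | AAdd s t => aeval s + aeval t
  | AMul s t => aeval s * aeval t
  end.

Hypothesis phiC : forall c b, b * phi c = phi c * b.
Hypothesis f_rel : forall s t, rel s t -> aeval s = aeval t.

Lemma aeval_congr s t : acongr s t -> aeval s = aeval t.
Proof.
elim=> //= {s t}.
- by move=> s t u _ -> _ ->.
- by move=> s s' t t' _ -> _ ->.
- by move=> s s' t t' _ -> _ ->.
- by move=> s t u; rewrite addrA.
- by move=> s t; rewrite addrC.
- by move=> s; rewrite rmorph0 add0r.
- by move=> s; rewrite rmorphN rmorph1 mulN1r addNr rmorph0.
- by move=> s t u; rewrite mulrA.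
- by move=> s; rewrite rmorph1 mul1r.
- by move=> s; rewrite rmorph1 mulr1.
- by move=> s t u; rewrite mulrDl.
- by move=> s t u; rewrite mulrDr.
- by move=> a b; rewrite rmorphD.
- by move=> a b; rewrite rmorphM.
Qed.

Definition alift (x : apres) : B := aeval (arep x).

Lemma alift_cls t : alift (acls t) = aeval t.
Proof. exact/aeval_congr/acls_rep. Qed.

Lemma alift_gen a : alift (agen a) = f a.
Proof. exact: alift_cls. Qed.

Lemma alift_scale c x : alift (c *: x) = phi c * alift x.
Proof. by elim/apresW: x => s; rewrite -[_ *: _]aclsM !alift_cls. Qed.

Lemma aliftM : {morph alift : x y / x * y}.
Proof.
by elim/apresW=> s; elim/apresW=> t; rewrite -[_ * _]aclsM !alift_cls.
Qed.

Lemma alift1 : alift 1 = 1.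
Proof. by rewrite alift_cls /= rmorph1. Qed.

Lemma aliftD : {morph alift : x y / x + y}.
Proof.
by elim/apresW=> s; elim/apresW=> t; rewrite -[_ + _]aclsD !alift_cls.
Qed.

Lemma aliftB : zmod_morphism alift.
Proof.
by move=> x y; rewrite aliftD -scaleN1r alift_scale rmorphN rmorph1 mulN1r.
Qed.
End Lift.
End AlgebraPresentation.

Section TensorProduct.
Variables (k : comNzRingType) (A B : algType k).

Inductive tens_rel : zterm (A * B) -> zterm (A * B) -> Prop :=
| tens_addl a a' b :
    tens_rel (ZGen (a + a', b)) (ZAdd (ZGen (a, b)) (ZGen (a', b)))
| tens_addr a b b' :
    tens_rel (ZGen (a, b + b')) (ZAdd (ZGen (a, b)) (ZGen (a, b')))
| tens_bal (c : k) a b : tens_rel (ZGen (c *: a, b)) (ZGen (a, c *: b)).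

Definition tens := zpres tens_rel.
HB.instance Definition _ := GRing.Zmodule.on tens.

Definition tmk (a : A) (b : B) : tens := zgen tens_rel (a, b).

Lemma tmkDl a a' b : tmk (a + a') b = tmk a b + tmk a' b.
Proof. by rewrite -[RHS]zclsD; apply/zclsE/zc_rel/tens_addl. Qed.

Lemma tmkDr a b b' : tmk a (b + b') = tmk a b + tmk a b'.
Proof. by rewrite -[RHS]zclsD; apply/zclsE/zc_rel/tens_addr. Qed.

Lemma tmkZ (c : k) a b : tmk (c *: a) b = tmk a (c *: b).
Proof. exact/zclsE/zc_rel/tens_bal. Qed.

Lemma tens_ind (P : tens -> Prop) :
    (forall a b, P (tmk a b)) -> P 0 -> (forall x y, P x -> P y -> P (x + y)) ->
    (forall x, P x -> P (- x)) -> forall x, P x.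
Proof. by move=> Pt; apply: zpres_ind => -[a b]; apply: Pt. Qed.

Lemma tens_liftP (V : zmodType) (f : A * B -> V) :
    (forall a a' b, f (a + a', b) = f (a, b) + f (a', b)) ->
    (forall a b b', f (a, b + b') = f (a, b) + f (a, b')) ->
    (forall (c : k) a b, f (c *: a, b) = f (a, c *: b)) ->
  forall s t, tens_rel s t -> zeval f s = zeval f t.
Proof. by move=> fl fr fz s t; case=> *; rewrite /= ?fl ?fr ?fz. Qed.

Definition tmulg (p q : A * B) : tens := tmk (p.1 * q.1) (p.2 * q.2).

Lemma tmulg_relr p s t : tens_rel s t -> zeval (tmulg p) s = zeval (tmulg p) t.
Proof.
apply: tens_liftP => *; rewrite /tmulg /=.
- by rewrite mulrDr tmkDl.
- by rewrite mulrDr tmkDr.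
- by rewrite -scalerAr tmkZ scalerAr.
Qed.

Lemma tmulg_rell q s t : tens_rel s t -> zeval (tmulg^~ q) s = zeval (tmulg^~ q) t.
Proof.
apply: (tens_liftP (f := tmulg^~ q)) => *; rewrite /tmulg /=.
- by rewrite mulrDl tmkDl.
- by rewrite mulrDl tmkDr.
- by rewrite -scalerAl tmkZ scalerAl.
Qed.

(* [tmk a b * tmk a' b' = tmk (a * a') (b * b')], see [tmkM]. *)
Definition tmul (x y : tens) : tens := zlift2 tmulg x y.

Lemma tmkM a b a' b' : tmul (tmk a b) (tmk a' b') = tmk (a * a') (b * b').
Proof. exact: (zlift2_gen tmulg_relr tmulg_rell). Qed.

Let tmulBl y : zmod_morphism (tmul^~ y).
Proof. exact: (zlift2Bl tmulg_rell). Qed.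

Let tmulBr x : zmod_morphism (tmul x).
Proof. exact: (zlift2Br tmulg_relr tmulg_rell). Qed.

Lemma tmulDl : left_distributive tmul +%R.
Proof. by move=> x y z; apply: (zmmD (tmulBl z)). Qed.

Lemma tmulDr : right_distributive tmul +%R.
Proof. by move=> x y z; apply: (zmmD (tmulBr x)). Qed.

Let tmul0l y : tmul 0 y = 0. Proof. exact: (zmm0 (tmulBl y)). Qed.
Let tmul0r x : tmul x 0 = 0. Proof. exact: (zmm0 (tmulBr x)). Qed.
Let tmulNl x y : tmul (- x) y = - tmul x y.
Proof. exact: (zmmN (tmulBl y)). Qed.
Let tmulNr x y : tmul x (- y) = - tmul x y.
Proof. exact: (zmmN (tmulBr x)). Qed.

Lemma tmulA : associative tmul.
Proof.
move=> x y z; elim/tens_ind: x => [a b||x x' IH IH'|x IH].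
- elim/tens_ind: y => [a' b'||y y' IH IH'|y IH].
  + elim/tens_ind: z => [a'' b''||z z' IH IH'|z IH].
    * by rewrite !tmkM !mulrA.
    * by rewrite !tmul0r.
    * by rewrite !tmulDr IH IH'.
    * by rewrite !tmulNr IH.
  + by rewrite tmul0l !tmul0r tmul0l.
  + by rewrite tmulDl !tmulDr tmulDl IH IH'.
  + by rewrite tmulNl !tmulNr tmulNl IH.
- by rewrite !tmul0l.
- by rewrite !tmulDl IH IH'.
- by rewrite !tmulNl IH.
Qed.

Lemma tmul1l : left_id (tmk 1 1) tmul.
Proof.
elim/tens_ind=> [a b||x y IH IH'|x IH].
- by rewrite tmkM !mul1r.
- exact: tmul0r.
- by rewrite tmulDr IH IH'.
- by rewrite tmulNr IH.
Qed.

Lemma tmul1r : right_id (tmk 1 1) tmul.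
Proof.
elim/tens_ind=> [a b||x y IH IH'|x IH].
- by rewrite tmkM !mulr1.
- exact: tmul0l.
- by rewrite tmulDl IH IH'.
- by rewrite tmulNl IH.
Qed.

HB.instance Definition _ :=
  GRing.Zmodule_isPzRing.Build tens tmulA tmul1l tmul1r tmulDl tmulDr.

Lemma tmk_mul a b a' b' : tmk a b * tmk a' b' = tmk (a * a') (b * b').
Proof. exact: tmkM. Qed.

Lemma tmk0l b : tmk 0 b = 0.
Proof. by apply: (addIr (tmk 0 b)); rewrite -tmkDl !add0r. Qed.

Lemma tmk0r a : tmk a 0 = 0.
Proof. by apply: (addIr (tmk a 0)); rewrite -tmkDr !add0r. Qed.

Lemma tmkX a b n : tmk a b ^+ n = tmk (a ^+ n) (b ^+ n).
Proof. by elim: n => [|n IH]; rewrite ?expr0 // !exprS IH tmk_mul. Qed.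

Definition tscal (c : k) : tens := tmk c%:A 1.

Lemma tscalB : zmod_morphism tscal.
Proof.
move=> c c'; apply/eqP; rewrite eq_sym subr_eq; apply/eqP.
by rewrite -tmkDl -scalerDl subrK.
Qed.

Lemma tscalM : monoid_morphism tscal.
Proof.
split=> [|c c']; first by rewrite /tscal scale1r.
by rewrite /tscal tmk_mul mulr1 -scalerAl mul1r scalerA.
Qed.

HB.instance Definition _ := GRing.isZmodMorphism.Build k tens tscal tscalB.
HB.instance Definition _ := GRing.isMonoidMorphism.Build k tens tscal tscalM.

Lemma tscalC (c : k) x : x * tscal c = tscal c * x.
Proof.
elim/tens_ind: x => [a b||x y IH IH'|x IH].
- by rewrite !tmk_mul mulr1 mul1r -scalerAr mulr1 -scalerAl mul1r.
- by rewrite mul0r mulr0.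
- by rewrite mulrDl mulrDr IH IH'.
- by rewrite mulNr mulrN IH.
Qed.

Definition tscale (c : k) (x : tens) : tens := tscal c * x.

Lemma tscaleA a b x : tscale a (tscale b x) = tscale (a * b) x.
Proof. by rewrite /tscale rmorphM mulrA. Qed.

Lemma tscale1 : left_id 1 tscale.
Proof. by move=> x; rewrite /tscale rmorph1 mul1r. Qed.

Lemma tscaleDr : right_distributive tscale +%R.
Proof. by move=> a x y; rewrite /tscale mulrDr. Qed.

Lemma tscaleDl x : {morph tscale^~ x : a b / a + b}.
Proof. by move=> a b; rewrite /tscale rmorphD mulrDl. Qed.

HB.instance Definition _ :=
  GRing.Zmodule_isLmodule.Build k tens tscaleA tscale1 tscaleDr tscaleDl.
End TensorProduct.

(* Gaussian binomials: they vanish at a primitive [d]-th root of unity, so    *)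
(* that the image of [h] under the comultiplication below satisfies h^d = 0.  *)
Fixpoint qbinom (K : fieldType) (q : K) (n i : nat) : K :=
  match n, i with
  | _, 0%N => 1
  | 0%N, _.+1 => 0
  | n'.+1, i'.+1 => qbinom q n' i' + q ^+ i * qbinom q n' i
  end.

Section QBinomial.
Variables (K : fieldType) (q : K).

Lemma qbinom0 n : qbinom q n 0 = 1. Proof. by case: n. Qed.

Lemma qbinomS n i :
  qbinom q n.+1 i.+1 = qbinom q n i + q ^+ i.+1 * qbinom q n i.+1.
Proof. by []. Qed.

Lemma qbinom_absorb n i :
  (1 - q ^+ i.+1) * qbinom q n.+1 i.+1 = (1 - q ^+ n.+1) * qbinom q n i.
Proof.
elim: n i => [|n IH] i.
  by case: i => [|i] /=; rewrite ?mulr0 ?addr0 ?mulr1 ?add0r ?mulr0.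
rewrite qbinomS mulrDr mulrCA IH.
case: i => [|i].
  rewrite !qbinom0 (exprS q n.+1) expr1; ring.
have EX := qbinomS n i; have EI := IH i.
move: (qbinom q n.+1 i.+1) EX EI => X EX EI.
have uZ : q ^+ i.+1 * qbinom q n i.+1 = X - qbinom q n i by rewrite EX addrC addKr.
rewrite (exprS q i.+1) (exprS q n.+1).
transitivity ((1 - q * q ^+ i.+1) * X
    + q * ((1 - q ^+ n.+1) * (q ^+ i.+1 * qbinom q n i.+1))); first by ring.
rewrite uZ (mulrBr (1 - q ^+ n.+1)) -EI; ring.
Qed.

Lemma qbinom_gt n i : (n < i)%N -> qbinom q n i = 0.
Proof.
elim: n i => [|n IH] [|i] //= lt_ni.
by rewrite !IH ?mulr0 ?addr0 // ltnW.
Qed.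

Lemma qbinomnn n : qbinom q n n = 1.
Proof. by elim: n => //= n ->; rewrite qbinom_gt // mulr0 addr0. Qed.

Lemma qbinom_prim d i : d.-primitive_root q -> (0 < i < d)%N -> qbinom q d i = 0.
Proof.
case: d i => [|d] [|i] //= prim_q lt_id.
have := qbinom_absorb d i; rewrite (prim_expr_order prim_q) subrr mul0r.
move/eqP; rewrite mulf_eq0 subr_eq0 eq_sym -(prim_order_dvd prim_q).
by rewrite gtnNdvd //= => /eqP.
Qed.

Variables (B : pzRingType) (phi : {rmorphism K -> B}).
Hypothesis phiC : forall c b, b * phi c = phi c * b.

Lemma qcommX (a b : B) i : b * a = phi q * (a * b) ->
  b * a ^+ i = phi (q ^+ i) * (a ^+ i * b).
Proof.
move=> ba; elim: i => [|i IH]; first by rewrite !expr0 rmorph1 mulr1 !mul1r.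
rewrite [a ^+ _]exprSr mulrA IH -!mulrA ba (mulrA _ (phi q)) phiC.
by rewrite exprSr rmorphM !mulrA.
Qed.

Lemma qbinom_expand (a b : B) n : b * a = phi q * (a * b) ->
  (b + a) ^+ n = \sum_(i < n.+1) phi (qbinom q n i) * (a ^+ i * b ^+ (n - i)).
Proof.
move=> ba; elim: n => [|n IH].
  by rewrite big_ord1 /= expr0 rmorph1 !mul1r.
rewrite exprS IH mulrDl !mulr_sumr.
have -> : \sum_(i < n.+1) b * (phi (qbinom q n i) * (a ^+ i * b ^+ (n - i))) =
    \sum_(i < n.+2) phi (q ^+ i * qbinom q n i) * (a ^+ i * b ^+ (n.+1 - i)).
  rewrite [RHS]big_ord_recr /= qbinom_gt // mulr0 rmorph0 mul0r addr0.
  apply: eq_bigr => i _ /=; have le_in : (i <= n)%N by rewrite -ltnS.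
  rewrite mulrA phiC -mulrA (mulrA b (a ^+ i)) (qcommX i ba) [q ^+ i * _]mulrC rmorphM.
  by rewrite subSn // exprS !mulrA.
rewrite big_ord_recl [RHS]big_ord_recl /= !mul1r qbinom0 !subn0 -addrA.
congr (_ + _); rewrite -big_split; apply: eq_bigr => i _ /=.
rewrite /bump /= !add1n subSS rmorphD mulrDl addrC; congr (_ + _).
by rewrite mulrA phiC -mulrA (mulrA a) -exprS.
Qed.

Lemma qbinom_nilp (a b : B) d : d.-primitive_root q -> b * a = phi q * (a * b) ->
  a ^+ d = 0 -> b ^+ d = 0 -> (b + a) ^+ d = 0.
Proof.
move=> prim_q ba ad bd; rewrite qbinom_expand // big1 // => i _.
have [-> | i_gt0] := posnP i; first by rewrite subn0 bd !mulr0.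
have [lt_id | le_di] := ltnP i d; first by rewrite qbinom_prim ?i_gt0 // rmorph0 mul0r.
have -> : i = d :> nat by apply/eqP; rewrite eqn_leq le_di -ltnS ltn_ord.
by rewrite ad mul0r mulr0.
Qed.
End QBinomial.

Section Taft.
Variable K : fieldType.

Record taft_datum := TaftDatum {
  tn : nat;
  td : nat;
  tq : K;
  tn_gt1 : (1 < tn)%N;
  td_gt1 : (1 < td)%N;
  td_dvd : (td %| tn)%N;
  tq_prim : td.-primitive_root tq
}.

Inductive taft_gen := TG | TH.

Definition apow (X : Type) (t : aterm K X) (n : nat) : aterm K X :=
  iter n (AMul t) (AScal X 1).

Variable D : taft_datum.
Let gT : aterm K taft_gen := AGen K TG.
Let hT : aterm K taft_gen := AGen K TH.

Inductive taft_rel : aterm K taft_gen -> aterm K taft_gen -> Prop :=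
| taft_gn : taft_rel (apow gT (tn D)) (AScal taft_gen 1)
| taft_hd : taft_rel (apow hT (td D)) (AScal taft_gen 0)
| taft_hg : taft_rel (AMul hT gT) (AMul (AScal taft_gen (tq D)) (AMul gT hT)).

Definition taft := apres taft_rel.
HB.instance Definition _ := GRing.PzRing.on taft.
HB.instance Definition _ := GRing.Lmodule.on taft.

Definition tg : taft := agen taft_rel TG.
Definition th : taft := agen taft_rel TH.

Lemma acls_apow t n : acls taft_rel (apow t n) = acls taft_rel t ^+ n.
Proof. by elim: n => [|n IH]; rewrite ?expr0 // exprS -IH aclsM. Qed.

Lemma tg_n : tg ^+ tn D = 1.
Proof. by rewrite -acls_apow; apply/aclsE/ac_rel/taft_gn. Qed.

Lemma th_d : th ^+ td D = 0.
Proof. by rewrite -acls_apow; apply/aclsE/ac_rel/taft_hd. Qed.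

Lemma th_tg : th * tg = tq D *: (tg * th).
Proof.
rewrite -[LHS]aclsM -[tg * th]aclsM -[RHS]aclsM.
exact/aclsE/ac_rel/taft_hg.
Qed.

Lemma aeval_apow (B : pzRingType) (phi : {rmorphism K -> B}) (f : taft_gen -> B) t n :
  aeval phi f (apow t n) = aeval phi f t ^+ n.
Proof. by elim: n => [|n IH] /=; rewrite ?rmorph1 ?expr0 // exprS IH. Qed.

Lemma taft_liftP (B : pzRingType) (phi : {rmorphism K -> B}) (f : taft_gen -> B) :
    f TG ^+ tn D = 1 -> f TH ^+ td D = 0 ->
    f TH * f TG = phi (tq D) * (f TG * f TH) ->
  forall s t, taft_rel s t -> aeval phi f s = aeval phi f t.
Proof.
by move=> gn hd hg s t; case; rewrite ?aeval_apow /= ?rmorph1 ?rmorph0.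
Qed.

Definition counit_gen (a : taft_gen) : K := if a is TG then 1 else 0.

Definition counit : taft -> K := alift [the {rmorphism K -> K} of idfun] counit_gen.

Lemma counit_rel s t : taft_rel s t ->
  aeval [the {rmorphism K -> K} of idfun] counit_gen s =
  aeval [the {rmorphism K -> K} of idfun] counit_gen t.
Proof.
apply: taft_liftP; rewrite /= ?expr1n ?mul0r ?mulr0 //.
by rewrite expr0n eqn0Ngt (ltnW (td_gt1 D)).
Qed.

Let counitC (c b : K) : b * idfun c = idfun c * b.
Proof. exact: mulrC. Qed.

Lemma counitM : monoid_morphism counit.
Proof.
split; first exact: (alift1 counitC counit_rel).
exact: (aliftM counitC counit_rel).
Qed.

HB.instance Definition _ := GRing.isZmodMorphism.Build taft K counit
  (aliftB counitC counit_rel).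
HB.instance Definition _ := GRing.isMonoidMorphism.Build taft K counit counitM.
HB.instance Definition _ := GRing.isScalable.Build K taft K *%R counit
  (alift_scale counitC counit_rel).

Lemma counit_g : counit tg = 1.
Proof. exact: (alift_gen counitC counit_rel). Qed.

Lemma counit_h : counit th = 0.
Proof. exact: (alift_gen counitC counit_rel). Qed.

Lemma taft_neq0 : (1 : taft) != 0.
Proof.
apply/eqP=> /(congr1 counit); rewrite rmorph1 rmorph0.
by apply/eqP; apply: oner_neq0.
Qed.

HB.instance Definition _ := GRing.PzSemiRing_isNonZero.Build taft taft_neq0.
HB.instance Definition _ :=
  GRing.Lmodule_isLalgebra.Build K taft (@ap_scalerAl K taft_gen taft_rel).
HB.instance Definition _ :=
  GRing.Lalgebra_isAlgebra.Build K taft (@ap_scalerAr K taft_gen taft_rel).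

Lemma taft_ind (P : taft -> Prop) :
    P tg -> P th -> (forall c : K, P (c%:A)) ->
    (forall x y, P x -> P y -> P (x + y)) ->
    (forall x y, P x -> P y -> P (x * y)) -> forall x, P x.
Proof. by move=> Pg Ph; apply: apres_ind => -[]. Qed.

Local Notation HH := (tens taft taft).

Definition comult_gen (a : taft_gen) : HH :=
  match a with
  | TG => tmk tg tg
  | TH => tmk 1 th + tmk th tg
  end.

(* Algebra maps are prescribed on generators: see [comult_g], [comult_h],     *)
(* [counit_g] and [counit_h]. The antipode plays no role in the Green ring.   *)
Definition comult : taft -> HH := alift [the {rmorphism K -> HH} of @tscal K taft taft] comult_gen.

Lemma comult_rel s t : taft_rel s t ->
  aeval [the {rmorphism K -> HH} of @tscal K taft taft] comult_gen s =
  aeval [the {rmorphism K -> HH} of @tscal K taft taft] comult_gen t.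
Proof.
apply: taft_liftP => /=.
- by rewrite tmkX tg_n.
- apply: (@qbinom_nilp _ (tq D) _ [the {rmorphism K -> HH} of @tscal K taft taft]).
  + exact: tscalC.
  + exact: tq_prim.
  + by rewrite !tmk_mul mul1r mulr1 th_tg -tmkZ -scalerAl mul1r.
  + by rewrite tmkX th_d tmk0l.
  + by rewrite tmkX th_d tmk0r.
- rewrite mulrDl mulrDr mulrDr !tmk_mul !mul1r !mulr1 th_tg.
  by rewrite -!tmkZ -!scalerAl !mul1r.
Qed.

Let comultC (c : K) (b : HH) : b * tscal taft taft c = tscal taft taft c * b.
Proof. exact: tscalC. Qed.

Lemma comultM : monoid_morphism comult.
Proof.
split; first exact: (alift1 comultC comult_rel).
exact: (aliftM comultC comult_rel).
Qed.

HB.instance Definition _ := GRing.isZmodMorphism.Build taft HH comult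
  (aliftB comultC comult_rel).
HB.instance Definition _ := GRing.isMonoidMorphism.Build taft HH comult comultM.
HB.instance Definition _ := GRing.isScalable.Build K taft HH *:%R comult
  (alift_scale comultC comult_rel).

Lemma comult_g : comult tg = tmk tg tg.
Proof. exact: (alift_gen comultC comult_rel). Qed.

Lemma comult_h : comult th = tmk 1 th + tmk th tg.
Proof. exact: (alift_gen comultC comult_rel). Qed.
End Taft.

Section Modules.
Variables (K : fieldType) (H : algType K).

(* A finite dimensional left module, up to a choice of basis: [H] acts on the *)
(* column vectors of height [hdim], so that [hact (x * y) = hact x *m hact y]. *)
Record hmod := HMod {
  hdim : nat;
  hact :> {lrmorphism H -> 'M[K]_hdim}
}.

Definition hiso (V W : hmod) : Prop :=
  exists (P : 'M[K]_(hdim W, hdim V)) (Q : 'M[K]_(hdim V, hdim W)),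
    [/\ P *m Q = 1%:M, Q *m P = 1%:M & forall x, P *m V x = W x *m P].

Section Sum.
Variables V W : hmod.

Definition hsum_act (x : H) : 'M[K]_(hdim V + hdim W) :=
  block_mx (V x) 0 0 (W x).

Lemma hsum_actB : zmod_morphism hsum_act.
Proof.
by move=> x y; rewrite /hsum_act !rmorphB opp_block_mx add_block_mx !oppr0 !addr0.
Qed.

Lemma hsum_actM : monoid_morphism hsum_act.
Proof.
split=> [|x y]; rewrite /hsum_act ?rmorph1.
  by rewrite -[1 in LHS]/1%:M -[X in block_mx _ _ _ X]/1%:M -scalar_mx_block.
rewrite !rmorphM -[RHS]/(_ *m _) mulmx_block.
by rewrite !mulmx0 !mul0mx !addr0 !add0r.
Qed.

Lemma hsum_actZ : scalable hsum_act.
Proof.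
by move=> c x; rewrite /hsum_act !linearZ scale_block_mx !scaler0.
Qed.

HB.instance Definition _ := GRing.isZmodMorphism.Build H _ hsum_act hsum_actB.
HB.instance Definition _ := GRing.isMonoidMorphism.Build H _ hsum_act hsum_actM.
HB.instance Definition _ := GRing.isScalable.Build K H _ *:%R hsum_act hsum_actZ.

Definition hsum : hmod := HMod [the {lrmorphism H -> 'M[K]_(hdim V + hdim W)} of hsum_act].
End Sum.

Section TensorAction.
Variables V W : hmod.

Definition htens_gen (p : H * H) : 'M[K]_(hdim V * hdim W) := V p.1 *t W p.2.

Lemma tensmxDl m n p q (A A' : 'M[K]_(m, n)) (B : 'M[K]_(p, q)) :
  (A + A') *t B = A *t B + A' *t B.
Proof. by apply/matrixP=> i j; rewrite !mxE mulrDl. Qed.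

Lemma tensmxDr m n p q (A : 'M[K]_(m, n)) (B B' : 'M[K]_(p, q)) :
  A *t (B + B') = A *t B + A *t B'.
Proof. by apply/matrixP=> i j; rewrite !mxE mulrDr. Qed.

Lemma tensmxZl m n p q c (A : 'M[K]_(m, n)) (B : 'M[K]_(p, q)) :
  (c *: A) *t B = c *: (A *t B).
Proof. by apply/matrixP=> i j; rewrite !mxE mulrA. Qed.

Lemma tensmxZr m n p q c (A : 'M[K]_(m, n)) (B : 'M[K]_(p, q)) :
  A *t (c *: B) = c *: (A *t B).
Proof. by apply/matrixP=> i j; rewrite !mxE mulrCA. Qed.

Lemma tensmx11 m n : (1%:M : 'M[K]_m) *t (1%:M : 'M[K]_n) = 1%:M.
Proof.
apply/matrixP=> i j.
case: (mxtens_indexP i) => i1 i2; case: (mxtens_indexP j) => j1 j2.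
rewrite tensmxE !mxE -natrM mulnb; congr (_%:R).
by rewrite (can_eq (@mxtens_indexK _ _)) xpair_eqE.
Qed.

Lemma htens_rel s t : tens_rel s t -> zeval htens_gen s = zeval htens_gen t.
Proof.
apply: tens_liftP => *; rewrite /htens_gen /=.
- by rewrite rmorphD tensmxDl.
- by rewrite rmorphD tensmxDr.
- by rewrite !linearZ /= tensmxZl tensmxZr.
Qed.

(* [a \tensor b] acts on the tensor product of the underlying spaces *)
(* as the Kronecker product of the actions of [a] and of [b].        *)
Definition htens_act (t : tens H H) : 'M[K]_(hdim V * hdim W) := zlift htens_gen t.

Lemma htens_act_mk a b : htens_act (tmk a b) = V a *t W b.
Proof. exact: (zlift_gen htens_rel). Qed.

Lemma htens_actB : zmod_morphism htens_act.
Proof. exact: (zlift_is_additive htens_rel). Qed.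

HB.instance Definition _ := GRing.isZmodMorphism.Build (tens H H) _ htens_act htens_actB.

Lemma htens_actM : monoid_morphism htens_act.
Proof.
split=> [|x y]; first by rewrite htens_act_mk !rmorph1; apply: tensmx11.
elim/tens_ind: x => [a b||x x' IH IH'|x IH].
- elim/tens_ind: y => [a' b'||y y' IH IH'|y IH].
  + by rewrite tmk_mul !htens_act_mk !rmorphM; symmetry; apply: tensmx_mul.
  + by rewrite mulr0 !raddf0 mulr0.
  + by rewrite mulrDr !raddfD /= IH IH' mulrDr.
  + by rewrite mulrN !raddfN /= IH mulrN.
- by rewrite mul0r !raddf0 mul0r.
- by rewrite mulrDl !raddfD /= IH IH' mulrDl.
- by rewrite mulNr !raddfN /= IH mulNr.
Qed.

HB.instance Definition _ := GRing.isMonoidMorphism.Build (tens H H) _ htens_act htens_actM.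

Lemma htens_actZ : scalable htens_act.
Proof.
move=> c x; rewrite -[c *: x]/(tscal H H c * x) rmorphM /= htens_act_mk.
rewrite linearZ /= !rmorph1 tensmxZl tensmx11.
by rewrite -[LHS]/(_ *m _) -scalemxAl mul1mx.
Qed.

HB.instance Definition _ :=
  GRing.isScalable.Build K (tens H H) _ *:%R htens_act htens_actZ.
End TensorAction.

Lemma htens_act_ext (V W V' W' : hmod)
    (P : 'M[K]_(hdim V' * hdim W', hdim V * hdim W)) :
    (forall a b, P *m (V a *t W b) = (V' a *t W' b) *m P) ->
  forall t, P *m htens_act V W t = htens_act V' W' t *m P.
Proof.
move=> PE; elim/tens_ind=> [a b||x y IH IH'|x IH].
- by rewrite !htens_act_mk.
- by rewrite !raddf0 /= ?mulmx0 ?mul0mx.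
- by rewrite !raddfD /= ?mulmxDr ?mulmxDl IH IH'.
- by rewrite !raddfN /= ?mulmxN ?mulNmx IH.
Qed.

(* Matrix of the linear map sending the [j]-th basis vector to the [f j]-th. *)
Definition reindex_mx a b (f : 'I_a -> 'I_b) : 'M[K]_(b, a) :=
  \matrix_(i, j) (i == f j)%:R.

Lemma reindex_mxK a b (f : 'I_a -> 'I_b) (g : 'I_b -> 'I_a) :
  cancel g f -> reindex_mx f *m reindex_mx g = 1%:M.
Proof.
move=> gK; apply/matrixP=> i j; rewrite !mxE (bigD1 (g j)) //= !mxE eqxx mulr1 gK.
by rewrite big1 ?addr0 // => l /negPf ne; rewrite !mxE ne mulr0.
Qed.

Lemma reindex_mxP a b (f : 'I_a -> 'I_b) (g : 'I_b -> 'I_a)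
    (A : 'M[K]_a) (B : 'M[K]_b) : cancel f g -> cancel g f ->
    (forall i j, B (f i) (f j) = A i j) ->
  reindex_mx f *m A = B *m reindex_mx f.
Proof.
move=> fK gK AB; apply/matrixP=> i j; rewrite -(gK i) !mxE.
rewrite (bigD1 (g i)) //= !mxE eqxx mul1r big1 ?addr0; last first.
  by move=> l ne; rewrite !mxE (can_eq fK) eq_sym (negPf ne) mul0r.
rewrite (bigD1 (f j)) //= !mxE eqxx mulr1 big1 ?addr0 ?AB //.
by move=> l /negPf ne; rewrite !mxE ne mulr0.
Qed.

Lemma hiso_reindex (V W : hmod) (f : 'I_(hdim V) -> 'I_(hdim W)) g :
    cancel f g -> cancel g f ->
    (forall x, reindex_mx f *m V x = W x *m reindex_mx f) -> hiso V W.
Proof.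
by move=> fK gK fE; exists (reindex_mx f), (reindex_mx g); split;
  rewrite ?reindex_mxK.
Qed.
End Modules.

Section TaftModules.
Variables (K : fieldType) (D : taft_datum K).
Local Notation H := (taft D).
Local Notation hmod := (hmod H).

Section Tensor.
Variables V W : hmod.

(* The restriction along the comultiplication of the action of [H \otimes H]. *)
Definition ttens_act (x : H) : 'M[K]_(hdim V * hdim W) := htens_act V W (comult x).

Lemma ttens_actB : zmod_morphism ttens_act.
Proof. by move=> x y; rewrite /ttens_act !raddfB. Qed.

Lemma ttens_actM : monoid_morphism ttens_act.
Proof. by split=> [|x y]; rewrite /ttens_act ?rmorph1 ?rmorphM. Qed.

Lemma ttens_actZ : scalable ttens_act.
Proof. by move=> c x; rewrite /ttens_act !linearZ. Qed.

HB.instance Definition _ := GRing.isZmodMorphism.Build H _ ttens_act ttens_actB.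
HB.instance Definition _ := GRing.isMonoidMorphism.Build H _ ttens_act ttens_actM.
HB.instance Definition _ := GRing.isScalable.Build K H _ *:%R ttens_act ttens_actZ.

Definition ttens : hmod := HMod [the {lrmorphism H -> 'M[K]_(hdim V * hdim W)} of ttens_act].
End Tensor.

Definition triv_act (x : H) : 'M[K]_1 := (counit x)%:M.

Lemma triv_actB : zmod_morphism triv_act.
Proof. by move=> x y; rewrite /triv_act !raddfB. Qed.

Lemma triv_actM : monoid_morphism triv_act.
Proof. by split=> [|x y]; rewrite /triv_act ?rmorph1 ?rmorphM. Qed.

Lemma triv_actZ : scalable triv_act.
Proof. by move=> c x; rewrite /triv_act linearZ scale_scalar_mx. Qed.

HB.instance Definition _ := GRing.isZmodMorphism.Build H _ triv_act triv_actB.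
HB.instance Definition _ := GRing.isMonoidMorphism.Build H _ triv_act triv_actM.
HB.instance Definition _ := GRing.isScalable.Build K H _ *:%R triv_act triv_actZ.

Definition triv : hmod := HMod [the {lrmorphism H -> 'M[K]_1} of triv_act].

Lemma ttens_g V W : ttens V W (tg D) = V (tg D) *t W (tg D).
Proof. by rewrite /= /ttens_act comult_g htens_act_mk. Qed.

Lemma ttens_h V W :
  ttens V W (th D) = 1%:M *t W (th D) + V (th D) *t W (tg D).
Proof. by rewrite /= /ttens_act comult_h raddfD /= !htens_act_mk rmorph1. Qed.

Lemma intertwine_gen (V W : hmod) (P : 'M[K]_(hdim W, hdim V)) :
    P *m V (tg D) = W (tg D) *m P -> P *m V (th D) = W (th D) *m P ->
  forall x, P *m V x = W x *m P.
Proof.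
move=> Pg Ph; elim/taft_ind=> [||c|x y IH IH'|x y IH IH'] //.
- by rewrite !linearZ /= !rmorph1 -scalemxAl mulmx1 mul1mx.
- by rewrite !rmorphD mulmxDr mulmxDl IH IH'.
- by rewrite !rmorphM /= mulmxA IH -mulmxA IH' mulmxA.
Qed.

Lemma ttens_iso V V' W W' : hiso V V' -> hiso W W' -> hiso (ttens V W) (ttens V' W').
Proof.
move=> [P [Q [PQ QP PV]]] [P' [Q' [PQ' QP' PW]]].
exists (P *t P'), (Q *t Q'); split.
- by rewrite tensmx_mul PQ PQ' tensmx11.
- by rewrite tensmx_mul QP QP' tensmx11.
- by move=> x; apply: htens_act_ext => a b; rewrite !tensmx_mul PV PW.
Qed.

Definition distl (a b c : nat) (i : 'I_((a + b) * c)) : 'I_(a * c + b * c) :=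
  let: (u, w) := mxtens_unindex i in
  match split u with
  | inl v => lshift _ (mxtens_index (v, w))
  | inr v => rshift _ (mxtens_index (v, w))
  end.

Definition undistl (a b c : nat) (i : 'I_(a * c + b * c)) : 'I_((a + b) * c) :=
  match split i with
  | inl r => let: (v, w) := mxtens_unindex r in mxtens_index (lshift _ v, w)
  | inr r => let: (v, w) := mxtens_unindex r in mxtens_index (rshift _ v, w)
  end.

Lemma splitl m n (i : 'I_m) : split (lshift n i) = inl i.
Proof. exact: (unsplitK (inl i)). Qed.

Lemma splitr m n (i : 'I_n) : split (rshift m i) = inr i.
Proof. exact: (unsplitK (inr i)). Qed.

Variant split_spec m n : 'I_(m + n) -> Type :=
| SplitL i : split_spec (lshift n i)
| SplitR i : split_spec (rshift m i).

Lemma split_specP m n (i : 'I_(m + n)) : split_spec i.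
Proof. by rewrite -(splitK i); case: (split i) => j; constructor. Qed.

Lemma distlL a b c (v : 'I_a) (w : 'I_c) :
  distl (mxtens_index (lshift b v, w)) = lshift _ (mxtens_index (v, w)).
Proof. by rewrite /distl mxtens_indexK splitl. Qed.

Lemma distlR a b c (v : 'I_b) (w : 'I_c) :
  distl (mxtens_index (rshift a v, w)) = rshift _ (mxtens_index (v, w)).
Proof. by rewrite /distl mxtens_indexK splitr. Qed.

Lemma distlK a b c : cancel (@distl a b c) (@undistl a b c).
Proof.
move=> i; case: (mxtens_indexP i) => u w; case: (split_specP u) => v.
  by rewrite distlL /undistl splitl mxtens_indexK.
by rewrite distlR /undistl splitr mxtens_indexK.
Qed.

Lemma undistlK a b c : cancel (@undistl a b c) (@distl a b c).
Proof.
move=> i; case: (split_specP i) => r; case: (mxtens_indexP r) => v w.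
  by rewrite /undistl splitl mxtens_indexK distlL.
by rewrite /undistl splitr mxtens_indexK distlR.
Qed.

Lemma ttens_suml V V' W :
  hiso (ttens (hsum V V') W) (hsum (ttens V W) (ttens V' W)).
Proof.
apply: (hiso_reindex (V := ttens (hsum V V') W) (W := hsum (ttens V W) (ttens V' W))
  (@distlK _ _ _) (@undistlK _ _ _)) => x /=.
rewrite /hsum_act /= /ttens_act.
elim/tens_ind: (comult x) => [a b||y y' IH IH'|y IH].
- rewrite !htens_act_mk.
  apply: (reindex_mxP (@distlK _ _ _) (@undistlK _ _ _)) => i j.
  case: (mxtens_indexP i) => u w; case: (mxtens_indexP j) => u' w'.
  rewrite tensmxE /= /hsum_act.
  by case: (split_specP u) => v; case: (split_specP u') => v';
    rewrite ?distlL ?distlR ?block_mxEul ?block_mxEur ?block_mxEdl ?block_mxEdr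
      ?tensmxE ?[(0 : 'M__) _ _]mxE ?mul0r.
- by rewrite !raddf0 /= ?mulmx0 block_mx0 mul0mx.
- rewrite !raddfD /= ?mulmxDr IH IH' -mulmxDl add_block_mx !addr0 //.
- by rewrite !raddfN /= ?mulmxN IH -mulNmx opp_block_mx !oppr0.
Qed.

Definition distr (a b c : nat) (i : 'I_(c * (a + b))) : 'I_(c * a + c * b) :=
  let: (w, u) := mxtens_unindex i in
  match split u with
  | inl v => lshift _ (mxtens_index (w, v))
  | inr v => rshift _ (mxtens_index (w, v))
  end.

Definition undistr (a b c : nat) (i : 'I_(c * a + c * b)) : 'I_(c * (a + b)) :=
  match split i with
  | inl r => let: (w, v) := mxtens_unindex r in mxtens_index (w, lshift _ v)
  | inr r => let: (w, v) := mxtens_unindex r in mxtens_index (w, rshift _ v)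
  end.

Lemma distrL a b c (v : 'I_a) (w : 'I_c) :
  distr (mxtens_index (w, lshift b v)) = lshift _ (mxtens_index (w, v)).
Proof. by rewrite /distr mxtens_indexK splitl. Qed.

Lemma distrR a b c (v : 'I_b) (w : 'I_c) :
  distr (mxtens_index (w, rshift a v)) = rshift _ (mxtens_index (w, v)).
Proof. by rewrite /distr mxtens_indexK splitr. Qed.

Lemma distrK a b c : cancel (@distr a b c) (@undistr a b c).
Proof.
move=> i; case: (mxtens_indexP i) => w u; case: (split_specP u) => v.
  by rewrite distrL /undistr splitl mxtens_indexK.
by rewrite distrR /undistr splitr mxtens_indexK.
Qed.

Lemma undistrK a b c : cancel (@undistr a b c) (@distr a b c).
Proof.
move=> i; case: (split_specP i) => r; case: (mxtens_indexP r) => w v.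
  by rewrite /undistr splitl mxtens_indexK distrL.
by rewrite /undistr splitr mxtens_indexK distrR.
Qed.

Lemma ttens_sumr V V' W :
  hiso (ttens W (hsum V V')) (hsum (ttens W V) (ttens W V')).
Proof.
apply: (hiso_reindex (V := ttens W (hsum V V')) (W := hsum (ttens W V) (ttens W V'))
  (@distrK _ _ _) (@undistrK _ _ _)) => x /=.
rewrite /hsum_act /= /ttens_act.
elim/tens_ind: (comult x) => [a b||y y' IH IH'|y IH].
- rewrite !htens_act_mk.
  apply: (reindex_mxP (@distrK _ _ _) (@undistrK _ _ _)) => i j.
  case: (mxtens_indexP i) => w u; case: (mxtens_indexP j) => w' u'.
  rewrite tensmxE /= /hsum_act.
  by case: (split_specP u) => v; case: (split_specP u') => v';
    rewrite ?distrL ?distrR ?block_mxEul ?block_mxEur ?block_mxEdl ?block_mxEdr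
      ?tensmxE ?[(0 : 'M__) _ _]mxE ?mulr0.
- by rewrite !raddf0 /= ?mulmx0 block_mx0 mul0mx.
- rewrite !raddfD /= ?mulmxDr IH IH' -mulmxDl add_block_mx !addr0 //.
- by rewrite !raddfN /= ?mulmxN IH -mulNmx opp_block_mx !oppr0.
Qed.

Definition assocf (a b c : nat) (i : 'I_(a * (b * c))) : 'I_(a * b * c) :=
  let: (u, vw) := mxtens_unindex i in
  let: (v, w) := mxtens_unindex vw in mxtens_index (mxtens_index (u, v), w).

Definition unassocf (a b c : nat) (i : 'I_(a * b * c)) : 'I_(a * (b * c)) :=
  let: (uv, w) := mxtens_unindex i in
  let: (u, v) := mxtens_unindex uv in mxtens_index (u, mxtens_index (v, w)).

Lemma assocfE a b c (u : 'I_a) (v : 'I_b) (w : 'I_c) :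
  assocf (mxtens_index (u, mxtens_index (v, w))) =
  mxtens_index (mxtens_index (u, v), w).
Proof. by rewrite /assocf !mxtens_indexK. Qed.

Lemma assocfK a b c : cancel (@assocf a b c) (@unassocf a b c).
Proof.
move=> i; case: (mxtens_indexP i) => u vw; case: (mxtens_indexP vw) => v w.
by rewrite assocfE /unassocf !mxtens_indexK.
Qed.

Lemma unassocfK a b c : cancel (@unassocf a b c) (@assocf a b c).
Proof.
move=> i; case: (mxtens_indexP i) => uv w; case: (mxtens_indexP uv) => u v.
by rewrite /unassocf !mxtens_indexK assocfE.
Qed.

Lemma tensmxA_reindex a b c (A : 'M[K]_a) (B : 'M[K]_b) (C : 'M[K]_c) :
  reindex_mx K (@assocf a b c) *m (A *t (B *t C)) =
  ((A *t B) *t C) *m reindex_mx K (@assocf a b c).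
Proof.
apply: (reindex_mxP (@assocfK _ _ _) (@unassocfK _ _ _)) => i j.
case: (mxtens_indexP i) => u vw; case: (mxtens_indexP vw) => v w.
case: (mxtens_indexP j) => u' vw'; case: (mxtens_indexP vw') => v' w'.
by rewrite !assocfE !tensmxE mulrA.
Qed.

Lemma ttensA U V W : hiso (ttens U (ttens V W)) (ttens (ttens U V) W).
Proof.
apply: (hiso_reindex (V := ttens U (ttens V W)) (W := ttens (ttens U V) W)
  (@assocfK _ _ _) (@unassocfK _ _ _)).
apply: intertwine_gen.
- by rewrite !ttens_g tensmxA_reindex.
- rewrite !ttens_h !ttens_g tensmxDr tensmxDl -tensmx11 !mulmxDr !mulmxDl.
  by rewrite -addrA !tensmxA_reindex.
Qed.

Definition unitlf (a : nat) (i : 'I_(1 * a)) : 'I_a := (mxtens_unindex i).2.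
Definition ununitlf (a : nat) (i : 'I_a) : 'I_(1 * a) := mxtens_index (ord0, i).

Lemma unitlfK a : cancel (@unitlf a) (@ununitlf a).
Proof.
move=> i; case: (mxtens_indexP i) => u v; rewrite /unitlf /ununitlf mxtens_indexK.
by rewrite (ord1 u).
Qed.

Lemma ununitlfK a : cancel (@ununitlf a) (@unitlf a).
Proof. by move=> i; rewrite /unitlf /ununitlf mxtens_indexK. Qed.

Lemma ttens1l V : hiso (ttens triv V) V.
Proof.
apply: (hiso_reindex (V := ttens triv V) (@unitlfK _) (@ununitlfK _)).
have E (c : K) (A : 'M[K]_(hdim V)) :
    reindex_mx K (@unitlf _) *m ((c%:M : 'M_1) *t A) = (c *: A) *m reindex_mx K (@unitlf _).
  apply: (reindex_mxP (@unitlfK _) (@ununitlfK _)) => i j.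
  case: (mxtens_indexP i) => u v; case: (mxtens_indexP j) => u' v'.
  by rewrite tensmxE /unitlf !mxtens_indexK !ord1 !mxE eqxx mulr1n.
apply: intertwine_gen.
- by rewrite ttens_g /= /triv_act counit_g E scale1r.
- by rewrite ttens_h /= /triv_act counit_h mulmxDr !E scale1r scale0r mul0mx addr0.
Qed.

Definition unitrf (a : nat) (i : 'I_(a * 1)) : 'I_a := (mxtens_unindex i).1.
Definition ununitrf (a : nat) (i : 'I_a) : 'I_(a * 1) := mxtens_index (i, ord0).

Lemma unitrfK a : cancel (@unitrf a) (@ununitrf a).
Proof.
move=> i; case: (mxtens_indexP i) => u v; rewrite /unitrf /ununitrf mxtens_indexK.
by rewrite (ord1 v).
Qed.

Lemma ununitrfK a : cancel (@ununitrf a) (@unitrf a).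
Proof. by move=> i; rewrite /unitrf /ununitrf mxtens_indexK. Qed.

Lemma ttens1r V : hiso (ttens V triv) V.
Proof.
apply: (hiso_reindex (V := ttens V triv) (@unitrfK _) (@ununitrfK _)).
have E (c : K) (A : 'M[K]_(hdim V)) :
    reindex_mx K (@unitrf _) *m (A *t (c%:M : 'M_1)) = (c *: A) *m reindex_mx K (@unitrf _).
  apply: (reindex_mxP (@unitrfK _) (@ununitrfK _)) => i j.
  case: (mxtens_indexP i) => u v; case: (mxtens_indexP j) => u' v'.
  by rewrite tensmxE /unitrf !mxtens_indexK !ord1 !mxE eqxx mulr1n mulrC.
apply: intertwine_gen.
- by rewrite ttens_g /= /triv_act counit_g E scale1r.
- rewrite ttens_h /= /triv_act counit_g counit_h mulmxDr !E scale1r scale0r mul0mx.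
  by rewrite add0r.
Qed.
End TaftModules.

Section GreenRing.
Variables (K : fieldType) (D : taft_datum K).
Local Notation hmod := (hmod (taft D)).

Inductive green_rel : zterm hmod -> zterm hmod -> Prop :=
| green_iso V W : hiso V W -> green_rel (ZGen V) (ZGen W)
| green_sum V W : green_rel (ZGen (hsum V W)) (ZAdd (ZGen V) (ZGen W)).

(* By [green_iso], the generators are the isomorphism classes of modules. *)
Definition green_ring := zpres green_rel.
HB.instance Definition _ := GRing.Zmodule.on green_ring.

Definition gcl (V : hmod) : green_ring := zgen green_rel V.

Lemma gcl_iso V W : hiso V W -> gcl V = gcl W.
Proof. by move=> VW; apply/zclsE/zc_rel/green_iso. Qed.

Lemma gcl_sum V W : gcl (hsum V W) = gcl V + gcl W.
Proof. by rewrite -[RHS]zclsD; apply/zclsE/zc_rel/green_sum. Qed.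

Lemma green_liftP (A : zmodType) (f : hmod -> A) :
    (forall V W, hiso V W -> f V = f W) ->
    (forall V W, f (hsum V W) = f V + f W) ->
  forall s t, green_rel s t -> zeval f s = zeval f t.
Proof. by move=> fi fs s t; case=> [V W /fi|V W] /=. Qed.

Lemma hiso_refl (V : hmod) : hiso V V.
Proof. by exists 1%:M, 1%:M; split=> [||x]; rewrite ?mul1mx ?mulmx1. Qed.

Definition gmulg (V W : hmod) : green_ring := gcl (ttens V W).

Lemma gmulg_relr V s t : green_rel s t -> zeval (gmulg V) s = zeval (gmulg V) t.
Proof.
apply: green_liftP => [W W' WW'|W W']; rewrite /gmulg.
- by apply/gcl_iso/ttens_iso => //; apply: hiso_refl.
- by rewrite -gcl_sum; apply/gcl_iso/ttens_sumr.
Qed.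

Lemma gmulg_rell W s t : green_rel s t -> zeval (gmulg^~ W) s = zeval (gmulg^~ W) t.
Proof.
apply: (green_liftP (f := gmulg^~ W)) => [V V' VV'|V V']; rewrite /gmulg.
- by apply/gcl_iso/ttens_iso => //; apply: hiso_refl.
- by rewrite -gcl_sum; apply/gcl_iso/ttens_suml.
Qed.

(* [gcl V * gcl W = gcl (ttens V W)], see [gcl_tens]. *)
Definition gmul (x y : green_ring) : green_ring := zlift2 gmulg x y.

Lemma gmulE V W : gmul (gcl V) (gcl W) = gcl (ttens V W).
Proof. exact: (zlift2_gen gmulg_relr gmulg_rell). Qed.

Let gmulBl y : zmod_morphism (gmul^~ y).
Proof. exact: (zlift2Bl gmulg_rell). Qed.

Let gmulBr x : zmod_morphism (gmul x).
Proof. exact: (zlift2Br gmulg_relr gmulg_rell). Qed.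

Lemma gmulDl : left_distributive gmul +%R.
Proof. by move=> x y z; apply: (zmmD (gmulBl z)). Qed.

Lemma gmulDr : right_distributive gmul +%R.
Proof. by move=> x y z; apply: (zmmD (gmulBr x)). Qed.

Let gmul0l y : gmul 0 y = 0. Proof. exact: (zmm0 (gmulBl y)). Qed.
Let gmul0r x : gmul x 0 = 0. Proof. exact: (zmm0 (gmulBr x)). Qed.
Let gmulNl x y : gmul (- x) y = - gmul x y.
Proof. exact: (zmmN (gmulBl y)). Qed.
Let gmulNr x y : gmul x (- y) = - gmul x y.
Proof. exact: (zmmN (gmulBr x)). Qed.

Lemma green_ind (P : green_ring -> Prop) :
    (forall V, P (gcl V)) -> P 0 -> (forall x y, P x -> P y -> P (x + y)) ->
    (forall x, P x -> P (- x)) -> forall x, P x.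
Proof. exact: zpres_ind. Qed.

Lemma gmulA : associative gmul.
Proof.
move=> x y z; elim/green_ind: x => [U||x x' IH IH'|x IH].
- elim/green_ind: y => [V||y y' IH IH'|y IH].
  + elim/green_ind: z => [W||z z' IH IH'|z IH].
    * by rewrite !gmulE; apply/gcl_iso/ttensA.
    * by rewrite !gmul0r.
    * by rewrite !gmulDr IH IH'.
    * by rewrite !gmulNr IH.
  + by rewrite gmul0l !gmul0r gmul0l.
  + by rewrite gmulDl !gmulDr gmulDl IH IH'.
  + by rewrite gmulNl !gmulNr gmulNl IH.
- by rewrite !gmul0l.
- by rewrite !gmulDl IH IH'.
- by rewrite !gmulNl IH.
Qed.

Lemma gmul1l : left_id (gcl (triv D)) gmul.
Proof.
elim/green_ind=> [V||x y IH IH'|x IH].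
- by rewrite gmulE; apply/gcl_iso/ttens1l.
- exact: gmul0r.
- by rewrite gmulDr IH IH'.
- by rewrite gmulNr IH.
Qed.

Lemma gmul1r : right_id (gcl (triv D)) gmul.
Proof.
elim/green_ind=> [V||x y IH IH'|x IH].
- by rewrite gmulE; apply/gcl_iso/ttens1r.
- exact: gmul0l.
- by rewrite gmulDl IH IH'.
- by rewrite gmulNl IH.
Qed.

HB.instance Definition _ :=
  GRing.Zmodule_isPzRing.Build green_ring gmulA gmul1l gmul1r gmulDl gmulDr.

Lemma gcl_tens V W : gcl V * gcl W = gcl (ttens V W).
Proof. exact: gmulE. Qed.

Definition gdim_gen (V : hmod) : int := (hdim V)%:Z.

Lemma hiso_dim (V W : hmod) : hiso V W -> hdim V = hdim W.
Proof.
have le (m n : nat) (P : 'M[K]_(m, n)) (Q : 'M[K]_(n, m)) : P *m Q = 1%:M -> (m <= n)%N.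
  by move=> PQ; rewrite -[m](@mxrank1 K) -PQ (leq_trans (mxrankM_maxr _ _)) // rank_leq_row.
by case=> P [Q [PQ QP _]]; apply/eqP; rewrite eqn_leq (le _ _ _ _ PQ) (le _ _ _ _ QP).
Qed.

Lemma gdim_rel s t : green_rel s t -> zeval gdim_gen s = zeval gdim_gen t.
Proof.
apply: green_liftP => [V W /hiso_dim|V W]; rewrite /gdim_gen; first by move->.
by rewrite /= PoszD.
Qed.

Definition gdim (x : green_ring) : int := zlift gdim_gen x.

Lemma gdim_cl V : gdim (gcl V) = (hdim V)%:Z.
Proof. exact: (zlift_gen gdim_rel). Qed.

Lemma gdimB : zmod_morphism gdim.
Proof. exact: (zlift_is_additive gdim_rel). Qed.

HB.instance Definition _ := GRing.isZmodMorphism.Build green_ring int gdim gdimB.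

Lemma gdim1 : gdim 1 = 1.
Proof. exact: gdim_cl. Qed.

Lemma green_neq0 : (1 : green_ring) != 0.
Proof. by apply/eqP=> /(congr1 gdim); rewrite gdim1 raddf0. Qed.

HB.instance Definition _ := GRing.PzSemiRing_isNonZero.Build green_ring green_neq0.
End GreenRing.

Section IntAlgebra.
Variable A : nzRingType.

HB.instance Definition _ := GRing.NzRing.on (zmodule A).

Lemma zmodule_scalerAl (c : int) (x y : zmodule A) : c *: (x * y) = (c *: x) * y.
Proof. by rewrite !scalezrE mulrzAl. Qed.

Lemma zmodule_scalerAr (c : int) (x y : zmodule A) : c *: (x * y) = x * (c *: y).
Proof. by rewrite !scalezrE mulrzAr. Qed.

HB.instance Definition _ :=
  GRing.Lmodule_isLalgebra.Build int (zmodule A) zmodule_scalerAl.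
HB.instance Definition _ :=
  GRing.Lalgebra_isAlgebra.Build int (zmodule A) zmodule_scalerAr.
End IntAlgebra.

Section GreenAlgebra.
Variables (C : comNzRingType) (K : fieldType) (D : taft_datum K).

(* The tensor product of [C] and the Green ring over the integers ([zmodule A] *)
(* is the ring [A] seen as an [int]-algebra), with [C] acting on the left     *)
(* factor: [c *: ga_tens c' x = ga_tens (c * c') x], see [ga_scale_tens].     *)
Definition green_algebra := tens (zmodule C) (zmodule (green_ring D)).
HB.instance Definition _ := GRing.PzRing.on green_algebra.

Definition ga_tens (c : C) (x : green_ring D) : green_algebra :=
  @tmk _ (zmodule C) (zmodule (green_ring D)) c x.

Definition ga_scale (c : C) (x : green_algebra) : green_algebra :=
  ga_tens c 1 * x.

Lemma ga_scale_tens a c x : ga_scale a (ga_tens c x) = ga_tens (a * c) x.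
Proof. by rewrite /ga_scale /ga_tens [LHS]tmk_mul mul1r. Qed.

Lemma ga_scaleA a b x : ga_scale a (ga_scale b x) = ga_scale (a * b) x.
Proof. by rewrite /ga_scale mulrA [in LHS]tmk_mul mulr1. Qed.

Lemma ga_scale1 : left_id 1 ga_scale.
Proof. by move=> x; apply: mul1r. Qed.

Lemma ga_scaleDr : right_distributive ga_scale +%R.
Proof. by move=> a x y; apply: mulrDr. Qed.

Lemma ga_scaleDl x : {morph ga_scale^~ x : a b / a + b}.
Proof. by move=> a b; rewrite /ga_scale -mulrDl; congr (_ * _); apply: tmkDl. Qed.

HB.instance Definition _ :=
  GRing.Zmodule_isLmodule.Build C green_algebra ga_scaleA ga_scale1 ga_scaleDr ga_scaleDl.

Definition ga_dim_gen (p : zmodule C * zmodule (green_ring D)) : C :=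
  (p.1 : C) *~ gdim (p.2 : green_ring D).

Lemma ga_dim_rel s t : tens_rel s t -> zeval ga_dim_gen s = zeval ga_dim_gen t.
Proof.
apply: tens_liftP => *; rewrite /ga_dim_gen /=.
- by rewrite mulrzDl.
- by rewrite raddfD mulrzDr.
- by rewrite !scalezrE raddfMz -mulrzA; congr (_ *~ _); rewrite -mulrzr intz mulrC.
Qed.

Lemma green_algebra_neq0 : (1 : green_algebra) != 0.
Proof.
apply/eqP=> /(congr1 (zlift ga_dim_gen)).
rewrite (zlift_gen ga_dim_rel) (zmm0 (zlift_is_additive ga_dim_rel)).
rewrite /ga_dim_gen /= gdim1 => /eqP.
by rewrite (negPf (oner_neq0 C)).
Qed.

HB.instance Definition _ :=
  GRing.PzSemiRing_isNonZero.Build green_algebra green_algebra_neq0.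

Lemma ga_scalerAl (c : C) (x y : green_algebra) : c *: (x * y) = (c *: x) * y.
Proof. exact: mulrA. Qed.

Lemma ga_scalerAr (c : C) (x y : green_algebra) : c *: (x * y) = x * (c *: y).
Proof.
rewrite -[LHS]/(ga_tens c 1 * (x * y)) -[c *: y]/(ga_tens c 1 * y) !mulrA.
congr (_ * _); elim/tens_ind: x => [a b||x x' IH IH'|x IH].
- by rewrite /ga_tens !tmk_mul mulr1 mul1r; congr (tmk _ _); apply: (@mulrC C).
- by rewrite mul0r mulr0.
- by rewrite mulrDl mulrDr IH IH'.
- by rewrite mulNr mulrN IH.
Qed.

HB.instance Definition _ :=
  GRing.Lmodule_isLalgebra.Build C green_algebra ga_scalerAl.
HB.instance Definition _ :=
  GRing.Lalgebra_isAlgebra.Build C green_algebra ga_scalerAr.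
End GreenAlgebra.

Section Irreducible.
Variables (C : comNzRingType) (A : algType C).

Definition mod_iso (M N : lmodType A) : Prop :=
  exists f : {linear M -> N}, bijective f.

Definition irreducible_mod (M : lmodType A) : Prop :=
  (exists v : M, v != 0) /\
  forall S : {pred M}, submod_closed S -> S =i pred1 0 \/ S =i predT.

(* [M] is one-dimensional over [C], acting through the unit map [c |-> c%:A]. *)
Definition mod_dim1 (M : lmodType A) : Prop :=
  exists v : M, forall w : M, exists! c : C, w = c%:A *: v.

(* Up to isomorphism there are exactly [N] irreducible [A]-modules. *)
Definition num_irreducible (N : nat) : Prop :=
  exists M : 'I_N -> lmodType A,
    [/\ forall i, irreducible_mod (M i),
        forall i j, mod_iso (M i) (M j) -> i = j &
        forall V, irreducible_mod V -> exists i, mod_iso V (M i)].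
End Irreducible.

(* Main.v *)
From HB Require Import structures.
Require Import Defs.
From mathcomp Require Import all_boot all_order all_algebra.
From mathcomp Require Import ring cyclic cyclotomic separable boolp reals mxtens complex.

(* Fix a primitive [n]-th root of unity [w] of [K] and [s] with [w ^ s = 1/q]. *)
(* The indecomposable modules are the uniserial [M(l, k)], [1 <= l <= d], with *)
(* [g v_b = w ^ (k + s b) v_b] and [h v_b = v_(b+1)]: if [h ^ l] is the        *)
(* highest nonzero power of [h] on [V], choose weight vectors [v] in [V] and   *)
(* [f] in [V*] with [f (h ^ l v) = 1]; they embed some [M(l+1, k)] in [V] and  *)
(* retract [V] onto it. In the Green ring,                                     *)
(*   M(1, k) M(l, i) = M(l, k + i),                                            *)
(*   M(2, 0) M(l, k) = M(l + 1, k) + M(l - 1, k + s)  for [l < d],             *)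
(*   M(2, 0) M(d, k) = M(d, k) + M(d, k + s).                                  *)
(* So the Green ring is commutative, generated by [Y = M(1, 1)] and            *)
(* [Z = M(2, 0)], with [Y ^ n = 1] and [(Z - 1 - Y ^ s) F_d(Y ^ s, Z) = 0],    *)
(* where the [F_l(t, z)] are the Dickson polynomials of the second kind. Both  *)
(* relations split over the complex numbers, so by Schur's argument [Y] and    *)
(* [Z] act on an irreducible module by scalars [y] and [z] that satisfy them.  *)
(* Conversely each such pair is a character: the multiplicities of the         *)
(* [M(l, k)] in [V] are read off the ranks of the powers of [h] on the weight  *)
(* spaces of [V], so a character is an explicit combination of these ranks.    *)
(* With [t = y ^ s], which satisfies [t ^ d = 1], [F_d(t, .)] has [d - 1]      *)
(* simple roots, and [1 + t] is one of them unless [t = 1], which happens for  *)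
(* [n / d] values of [y]: this gives [n (d - 1) + n / d] pairs.                *)

Set Implicit Arguments.
Unset Strict Implicit.
Unset Printing Implicit Defensive.

Import GRing.Theory.
Local Open Scope ring_scope.

(** An irreducible module over a commutative [C]-algebra all of whose elements act by scalars is a
    character, so the characters of the Green algebra have to be found and counted. Splitting off
    summands ([unis_summand], [green_span_ind]) shows that the classes of the M(l, k) span the Green
    ring. The product rules [gcl_unis1_mul], [gcl_unis2_mul] and [gcl_unis2_mul_top] then make it
    commutative and generated by Y and Z ([green_mulC], [green_gen_ind]). Upper bound: on an
    irreducible module, [irr_eigenvalue], fed by [irr_root_Y] and [irr_dickson], makes Y act by some
    y with y ^ n = 1 and Z by a root z of [('X - (1 + t)%:P) * dickson t d], where t = y ^ s. The
    pair (y, z) determines the module. Lower bound: [green_char] and [green_algebra_char] realize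
    every such pair by a character. Count: [dickson_top_roots] finds d - 1 values of z for each y,
    and one more when t = 1. Summing over the n values of y gives n (d - 1) + n / d. *)

(** * Roots of unity *)

Section RootsOfUnity.
Variable F : fieldType.

Lemma sum_root_unity n (x : F) : x ^+ n = 1 ->
  \sum_(a < n) x ^+ a = (n * (x == 1))%:R.
Proof.
move=> xn; have [-> | x1] := eqVneq x 1.
  by rewrite (eq_bigr (fun=> 1)) => [|a _]; rewrite ?expr1n // sumr_const card_ord muln1.
rewrite muln0; apply: (@mulfI _ (x - 1)); first by rewrite subr_eq0.
by rewrite -subrX1 xn subrr mulr0.
Qed.

Lemma prim_root_inv n (z x : F) : (0 < n)%N -> n.-primitive_root z ->
  x ^+ n = 1 -> exists s, z ^+ s = x^-1.
Proof.
move=> n0 zP xn; have /(prim_rootP zP)[i ->] : x^-1 ^+ n = 1 by rewrite exprVn xn invr1.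
by exists i.
Qed.
End RootsOfUnity.

(** As n is nonzero in [F], X ^ n - 1 is separable and has n distinct roots; a set of n distinct
    n-th roots of unity contains a primitive one. *)
Lemma closed_prim_root (F : closedFieldType) n : (0 < n)%N -> n%:R != 0 :> F ->
  exists z : F, n.-primitive_root z.
Proof.
move=> n0 nF; have [rs Ers] := closed_field_poly_normal ('X^n - 1 : {poly F}).
have mon : ('X^n - 1 : {poly F}) \is monic by rewrite monicXnsubC.
rewrite (monicP mon) scale1r in Ers.
have /hasP[z _ zP] : has n.-primitive_root rs; last by exists z.
apply: has_prim_root => //.
- by apply/allP=> x; rewrite -root_prod_XsubC -Ers unity_rootE rootE !hornerE subr_eq0.
- rewrite -separable_prod_XsubC -Ers; exact: separable_Xn_sub_1.
- by rewrite -ltnS -(size_prod_XsubC rs id) -Ers size_XnsubC.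
Qed.

Lemma prim_root_neq0 (F : fieldType) n (z : F) : (0 < n)%N -> n.-primitive_root z -> z != 0.
Proof.
move=> n0 /prim_expr_order zn; apply/eqP=> z0; move/eqP: zn.
by rewrite z0 expr0n gtn_eqF // eq_sym oner_eq0.
Qed.

Lemma tq_neq0 (K : fieldType) (D : taft_datum K) : tq D != 0.
Proof. exact: prim_root_neq0 (ltnW (td_gt1 D)) (tq_prim D). Qed.

(** * Uniserial modules *)

Section UniserialModules.
Variables (K : fieldType) (D : taft_datum K).
Local Notation H := (taft D).
Local Notation hmod := (hmod H).
Local Notation q := (tq D).
Local Notation g := (tg D).
Local Notation h := (th D).

Section OfGenerators.
Variables (l : nat) (G N : 'M[K]_l).
Hypotheses (Gn : G ^+ tn D = 1) (Nd : N ^+ td D = 0) (NG : N *m G = q *: (G *m N)).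

Let gen (a : taft_gen) : 'M[K]_l := if a is TG then G else N.
Let scal : {rmorphism K -> 'M[K]_l} := [the {rmorphism K -> 'M[K]_l} of @scalar_mx K l].

Definition taft_act : H -> 'M[K]_l := alift scal gen.

Let rel s t : @taft_rel K D s t -> aeval scal gen s = aeval scal gen t.
Proof.
apply: taft_liftP => //=; rewrite -[LHS]/(_ *m _) NG -[RHS]/(_ *m _).
by rewrite mul_scalar_mx.
Qed.

Let scalC (c : K) (B : 'M[K]_l) : B * scal c = scal c * B.
Proof. by rewrite -[LHS]/(_ *m _) -[RHS]/(_ *m _) scalar_mxC. Qed.

Let actM : monoid_morphism taft_act.
Proof. by split; [apply: (alift1 scalC rel) | apply: (aliftM scalC rel)]. Qed.

Let actZ : scalable taft_act.
Proof.
by move=> c x; rewrite /taft_act (alift_scale scalC rel) -[LHS]/(_ *m _) mul_scalar_mx.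
Qed.

HB.instance Definition _ :=
  GRing.isZmodMorphism.Build H 'M[K]_l taft_act (aliftB scalC rel).
HB.instance Definition _ := GRing.isMonoidMorphism.Build H 'M[K]_l taft_act actM.
HB.instance Definition _ := GRing.isScalable.Build K H 'M[K]_l *:%R taft_act actZ.

Definition hmod_of_gen : hmod := HMod [the {lrmorphism H -> 'M[K]_l} of taft_act].

Lemma hmod_of_gen_g : hmod_of_gen g = G.
Proof. exact: (alift_gen scalC rel). Qed.

Lemma hmod_of_gen_h : hmod_of_gen h = N.
Proof. exact: (alift_gen scalC rel). Qed.
End OfGenerators.

Lemma hactX (V : hmod) x k : V (x ^+ k.+1) = V x *m V (x ^+ k).
Proof. by rewrite exprS rmorphM. Qed.

Lemma hactXr (V : hmod) x k : V (x ^+ k.+1) = V (x ^+ k) *m V x.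
Proof. by rewrite exprSr rmorphM. Qed.

(* [vb k] is a basis vector for [k < l] and [0] for [k >= l]. *)
Definition vb l k : 'cV[K]_l := \col_i (i == k :> nat)%:R.

Lemma vb_out l k : (l <= k)%N -> vb l k = 0.
Proof.
move=> lk; apply/colP=> i; rewrite !mxE; case: eqP => // ik.
by move: (ltn_ord i); rewrite ik ltnNge lk.
Qed.

Lemma mul_vb m l (A : 'M[K]_(m, l)) (b : 'I_l) : A *m vb l b = col b A.
Proof.
apply/colP=> i; rewrite !mxE (bigD1 b) //= !mxE eqxx mulr1 big1 ?addr0 // => j jb.
by rewrite mxE (inj_eq val_inj) (negPf jb) mulr0.
Qed.

Lemma mx_vbP m l (A B : 'M[K]_(m, l)) :
  (forall b, (b < l)%N -> A *m vb l b = B *m vb l b) -> A = B.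
Proof.
move=> AB; apply/matrixP=> i j; move/colP/(_ i): (AB j (ltn_ord j)).
by rewrite !mul_vb !mxE.
Qed.

(* The cutoff at [td D] makes [unis l k] below a module for every [l]. *)
Definition shift_mx l : 'M[K]_l :=
  \matrix_(i, j) ((l <= td D)%N && (i == j.+1 :> nat))%:R.

Lemma shift_vb l b : (l <= td D)%N -> shift_mx l *m vb l b = vb l b.+1.
Proof.
move=> ld; have [bl | lb] := ltnP b l; last by rewrite !vb_out ?mulmx0 ?leqW.
by rewrite (mul_vb _ (Ordinal bl)); apply/colP=> i; rewrite !mxE ld.
Qed.

Variables (w : K) (s : nat).
Hypotheses (wP : (tn D).-primitive_root w) (ws : w ^+ s = q^-1).

(** Since hg = q gh, applying h multiplies a g-eigenvalue by 1/q = w ^ s; this dictates the exponent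
    [k + s * j]. *)
Definition weight_mx l k : 'M[K]_l :=
  \matrix_(i, j) (w ^+ (k + s * j) *+ (i == j :> nat)).

Lemma weight_vb l k b : weight_mx l k *m vb l b = w ^+ (k + s * b) *: vb l b.
Proof.
have [bl | lb] := ltnP b l; last by rewrite !vb_out ?mulmx0 ?scaler0.
by rewrite (mul_vb _ (Ordinal bl)); apply/colP=> i; rewrite !mxE /= mulr_natr.
Qed.

Lemma weight_mxX l k : weight_mx l k ^+ tn D = 1.
Proof.
apply: mx_vbP => b _; rewrite [RHS]mul1mx.
suff -> a : weight_mx l k ^+ a *m vb l b = (w ^+ (k + s * b)) ^+ a *: vb l b.
  by rewrite exprAC (prim_expr_order wP) expr1n scale1r.
elim: a => [|a IH]; first by rewrite !expr0 [LHS]mul1mx scale1r.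
by rewrite exprS -mulmxA IH -scalemxAr weight_vb scalerA -exprSr.
Qed.

Lemma shift_mxX_vb l a b : (l <= td D)%N -> shift_mx l ^+ a *m vb l b = vb l (b + a).
Proof.
move=> ld; elim: a => [|a IH]; first by rewrite expr0 addn0 [LHS]mul1mx.
by rewrite exprS -mulmxA IH shift_vb // addnS.
Qed.

Lemma shift_mxX l : shift_mx l ^+ td D = 0.
Proof.
have [ld | dl] := leqP l (td D).
  by apply: mx_vbP => b _; rewrite shift_mxX_vb // mul0mx vb_out // (leq_trans ld) ?leq_addl.
have -> : shift_mx l = 0 by apply/matrixP=> i j; rewrite !mxE leqNgt dl.
by rewrite expr0n gtn_eqF ?(ltnW (td_gt1 D)).
Qed.

Lemma shift_weight l k :
  shift_mx l *m weight_mx l k = q *: (weight_mx l k *m shift_mx l).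
Proof.
have [ld | dl] := leqP l (td D); last first.
  have -> : shift_mx l = 0 by apply/matrixP=> i j; rewrite !mxE leqNgt dl.
  by rewrite mul0mx mulmx0 scaler0.
apply: mx_vbP => b _; rewrite -scalemxAl -!mulmxA shift_vb // !weight_vb.
rewrite -scalemxAr shift_vb // scalerA; congr (_ *: _).
by rewrite mulnS addnCA [in RHS]exprD ws mulrA divff ?tq_neq0 // mul1r.
Qed.

(** The module M(l, k) described at the top. It is the zero module for l = 0, and h acts by zero
    when l exceeds [td D], hence the recurring condition [l <= td D]. *)
Definition unis l k : hmod :=
  hmod_of_gen (weight_mxX l k) (shift_mxX l) (shift_weight l k).

Lemma unis_g l k : unis l k g = weight_mx l k.
Proof. exact: hmod_of_gen_g. Qed.

Lemma unis_h l k : unis l k h = shift_mx l.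
Proof. exact: hmod_of_gen_h. Qed.

Lemma unis_hX l k a b : (l <= td D)%N -> unis l k (h ^+ a) *m vb l b = vb l (b + a).
Proof. by move=> ld; rewrite rmorphXn /= unis_h shift_mxX_vb. Qed.

Lemma hXg (V : hmod) a : V (h ^+ a) *m V g = q ^+ a *: (V g *m V (h ^+ a)).
Proof.
elim: a => [|a IH]; first by rewrite !expr0 rmorph1 mul1mx mulmx1 scale1r.
have hg : V h *m V g = q *: (V g *m V h).
  by rewrite -[LHS]/(_ * _) -rmorphM /= th_tg linearZ /= rmorphM.
by rewrite hactX -mulmxA IH -scalemxAr mulmxA hg -scalemxAl scalerA -exprSr -mulmxA.
Qed.

Lemma gX_weight (V : hmod) (v : 'cV_(hdim V)) k a : V g *m v = w ^+ k *: v ->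
  V g *m (V (h ^+ a) *m v) = w ^+ (k + s * a) *: (V (h ^+ a) *m v).
Proof.
move=> gv; apply: (@scalerI _ _ (q ^+ a)); first by rewrite expf_neq0 ?tq_neq0.
rewrite mulmxA [LHS]scalemxAl -hXg -!mulmxA gv -scalemxAr scalerA; congr (_ *: _).
by rewrite exprD exprM ws mulrCA -exprMn divff ?tq_neq0 // expr1n mulr1.
Qed.

Section HomFrom.
Variables (V : hmod) (l k : nat) (v : 'cV[K]_(hdim V)).
Hypotheses (ld : (l <= td D)%N) (gv : V g *m v = w ^+ k *: v).
Hypothesis hv : V (h ^+ l) *m v = 0.

(** The homomorphism from M(l, k) to [V] that sends the generator v_0 to [v]; it exists because [v]
    has weight w ^ k and is killed by h ^ l. *)
Definition unis_hom : 'M[K]_(hdim V, l) := \matrix_(i, j) (V (h ^+ j) *m v) i 0.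

Lemma unis_hom_vb b : unis_hom *m vb l b = V (h ^+ b) *m v.
Proof.
have [bl | lb] := ltnP b l.
  by rewrite (mul_vb _ (Ordinal bl)); apply/colP=> i; rewrite !mxE.
rewrite vb_out // mulmx0; have /subnK <- := lb.
by rewrite exprD rmorphM -mulmxA hv mulmx0.
Qed.

Lemma unis_homP x : unis_hom *m unis l k x = V x *m unis_hom.
Proof.
apply: (intertwine_gen (V := unis l k)) x; apply: mx_vbP => b _.
- rewrite unis_g -!mulmxA weight_vb -scalemxAr !unis_hom_vb.
  exact: esym (gX_weight _ gv).
- by rewrite unis_h -!mulmxA shift_vb // !unis_hom_vb hactX mulmxA.
Qed.
End HomFrom.
End UniserialModules.

(** * Decomposition into uniserial modules *)

(** Take a rank factorization E = QP. Then E ^ 2 = E reads Q (PQ) P = QP, and Q and P can be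
    cancelled because they have full rank. *)
Lemma idempotent_split (K : fieldType) n (E : 'M[K]_n) : E *m E = E ->
  exists r (P : 'M_(r, n)) (Q : 'M_(n, r)), P *m Q = 1%:M /\ Q *m P = E.
Proof.
move=> EE; exists (\rank E), (row_base E), (col_base E).
have QP : col_base E *m row_base E = E := mulmx_base E.
split=> //; apply: (row_full_inj (col_base_full E)).
apply: (row_free_inj (row_base_free E)).
by rewrite /= mulmx1 mulmxA -mulmxA QP.
Qed.

Section Complement.
Variables (K : fieldType) (H : algType K) (V : hmod H).

Section OfIdempotent.
Variables (r : nat) (P : 'M[K]_(r, hdim V)) (Q : 'M[K]_(hdim V, r)).
Hypotheses (PQ : P *m Q = 1%:M) (QPc : forall x, Q *m P *m V x = V x *m (Q *m P)).

(** The image of the idempotent [Q *m P] is a submodule since the idempotent commutes with the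
    action; here it is written in the coordinates given by [P] and [Q]. *)
Definition compl_act (x : H) : 'M[K]_r := P *m V x *m Q.

Let actB : zmod_morphism compl_act.
Proof. by move=> x y; rewrite /compl_act raddfB /= mulmxBr mulmxBl. Qed.

Let actM : monoid_morphism compl_act.
Proof.
split=> [|x y]; first by rewrite /compl_act rmorph1 mulmx1.
rewrite /compl_act rmorphM -[RHS]/(_ *m _) -[V x * V y]/(_ *m _) -!mulmxA.
rewrite (mulmxA Q P) (mulmxA (Q *m P)) QPc -!mulmxA PQ mulmx1.
by rewrite !mulmxA.
Qed.

Let actZ : scalable compl_act.
Proof. by move=> c x; rewrite /compl_act linearZ /= -scalemxAr -scalemxAl. Qed.

HB.instance Definition _ := GRing.isZmodMorphism.Build H 'M[K]_r compl_act actB.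
HB.instance Definition _ := GRing.isMonoidMorphism.Build H 'M[K]_r compl_act actM.
HB.instance Definition _ := GRing.isScalable.Build K H 'M[K]_r *:%R compl_act actZ.

Definition compl_hmod : hmod H := HMod [the {lrmorphism H -> 'M[K]_r} of compl_act].
End OfIdempotent.

(** A retract is a direct summand: the complement is the image of the idempotent 1 - BA. *)
Lemma hiso_sum_compl (U : hmod H) (A : 'M[K]_(hdim U, hdim V)) (B : 'M[K]_(hdim V, hdim U)) :
    A *m B = 1%:M -> (forall x, A *m V x = U x *m A) ->
    (forall x, B *m U x = V x *m B) ->
  exists V', hiso V (hsum U V').
Proof.
move=> AB AV BU; pose E := 1%:M - B *m A.
have EE : E *m E = E.
  rewrite {2}/E mulmxBr mulmx1 mulmxA /E mulmxBl mul1mx -mulmxA AB mulmx1.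
  by rewrite subrr mul0mx subr0.
have [r [P [Q [PQ QP]]]] := idempotent_split EE.
have Ec x : Q *m P *m V x = V x *m (Q *m P).
  by rewrite QP mulmxBl mulmxBr mul1mx mulmx1 -mulmxA AV !mulmxA BU.
have AQ : A *m Q = 0.
  have -> : Q = E *m Q by rewrite -QP -mulmxA PQ mulmx1.
  by rewrite mulmxA mulmxBr mulmx1 mulmxA AB mul1mx subrr mul0mx.
have PB : P *m B = 0.
  have -> : P = P *m E by rewrite -QP mulmxA PQ mul1mx.
  by rewrite -mulmxA mulmxBl mul1mx -mulmxA AB mulmx1 subrr mulmx0.
exists (compl_hmod PQ Ec), (col_mx A P), (row_mx B Q); split=> [||x].
- by rewrite mul_col_row AB AQ PB PQ -scalar_mx_block.
- by rewrite mul_row_col QP addrC subrK.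
- rewrite mul_col_mx mul_block_col !mul0mx addr0 add0r AV; congr col_mx.
  by rewrite /= /compl_act -!mulmxA -Ec !mulmxA PQ mul1mx.
Qed.
End Complement.

Section StructureTheorem.
Variables (K : fieldType) (D : taft_datum K).
Local Notation H := (taft D).
Local Notation hmod := (hmod H).
Local Notation q := (tq D).
Local Notation g := (tg D).
Local Notation h := (th D).
Local Notation n := (tn D).

Variables (w : K) (s : nat).
Hypotheses (wP : n.-primitive_root w) (ws : w ^+ s = q^-1).
Local Notation unis := (unis wP ws).

Lemma expr_s a b : w ^+ (a + s * b) = w ^+ a * q ^- b.
Proof. by rewrite exprD exprM ws exprVn. Qed.

(** The idempotent of the group algebra of the cyclic group generated by g that projects onto the
    g-eigenspace of w ^ i. *)
Definition weight_proj i : H := n%:R^-1 *: \sum_(a < n) w ^- (i * a) *: g ^+ a.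

Lemma nK0 : n%:R != 0 :> K.
Proof. exact: prim_root_natf_neq0 wP. Qed.

Lemma mul_g_weight_proj i : g * weight_proj i = w ^+ i *: weight_proj i.
Proof.
rewrite /weight_proj -scalerAr scalerA mulrC -scalerA; congr (_ *: _).
pose F a := w ^- (i * a) *: g ^+ a.
(* Cyclic reindexing: the terms at 0 and at n agree because g ^ n = 1 and w ^ n = 1. *)
have FS : \sum_(a < n) F a.+1 = \sum_(a < n) F a.
  apply: (addIr (F 0%N)); rewrite addrC -(big_ord_recl _ (fun a : 'I__ => F a)).
  rewrite big_ord_recr /=; congr (_ + _); rewrite /F muln0 !expr0 tg_n mulnC exprM.
  by rewrite (prim_expr_order wP) expr1n.
rewrite -[in RHS]FS mulr_sumr scaler_sumr; apply: eq_bigr => a _.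
rewrite -scalerAr -exprS scalerA mulnS exprD invfM mulrA divff ?mul1r //.
by rewrite expf_neq0 // (prim_root_neq0 _ wP) // ltnW ?tn_gt1.
Qed.

Lemma weight_proj_g i : weight_proj i * g = w ^+ i *: weight_proj i.
Proof.
rewrite -mul_g_weight_proj /weight_proj -scalerAl -scalerAr mulr_suml mulr_sumr.
by congr (_ *: _); apply: eq_bigr => a _; rewrite -scalerAl -scalerAr -exprS -exprSr.
Qed.

(** Orthogonality of characters: summing w ^ (- i a) over i leaves only the coefficient of g ^ 0. *)
Lemma sum_weight_proj : \sum_(i < n) weight_proj i = 1.
Proof.
rewrite -scaler_sumr exchange_big /=.
have E (a : 'I_n) : \sum_(i < n) w ^- (i * a) *: g ^+ a = (n * (a == 0 :> nat))%:R *: g ^+ a.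
  rewrite -scaler_suml; congr (_ *: _).
  under eq_bigr => i _ do rewrite mulnC exprM -exprVn.
  rewrite sum_root_unity; last by rewrite exprVn exprAC (prim_expr_order wP) expr1n invr1.
  rewrite -(inj_eq invr_inj) invrK invr1 -(prim_order_dvd wP).
  by case: posnP => [->|a0]; rewrite ?dvdn0 // gtnNdvd.
under eq_bigr => a _ do rewrite E.
have n0 : (0 < n)%N by rewrite ltnW ?tn_gt1.
rewrite (bigD1 (Ordinal n0)) //= muln1 expr0 big1 ?addr0 => [|a].
  by rewrite scalerA mulVf ?nK0 // scale1r.
by rewrite -val_eqE /= => /negPf->; rewrite muln0 scale0r.
Qed.

Section Retract.
Variables (V : hmod) (l k : nat) (f : 'rV[K]_(hdim V)).
Hypotheses (ld : (l < td D)%N) (fg : f *m V g = w ^+ (k + s * l) *: f).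
Hypothesis fh : f *m V (h ^+ l.+1) = 0.

Lemma fhX_weight a : (a <= l)%N ->
  f *m V (h ^+ a) *m V g = w ^+ (k + s * (l - a)) *: (f *m V (h ^+ a)).
Proof.
move=> al; rewrite -mulmxA hXg -scalemxAr mulmxA fg -scalemxAl scalerA.
congr (_ *: _); rewrite mulrC !expr_s -mulrA; congr (_ * _).
by rewrite -[in LHS](subnK al) exprD invfM -mulrA mulVf ?mulr1 ?expf_neq0 ?tq_neq0.
Qed.

(** Dual to [unis_hom]: a functional [f] of weight w ^ (k + s l) killed by h ^ (l + 1) gives the
    homomorphism from [V] to M(l + 1, k) whose coordinate on the last basis vector v_l is [f]
    itself. *)
Definition unis_cohom : 'M[K]_(l.+1, hdim V) :=
  \sum_(i < l.+1) vb K l.+1 i *m (f *m V (h ^+ (l - i))).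

Lemma unis_cohomP x : unis_cohom *m V x = unis l.+1 k x *m unis_cohom.
Proof.
apply: (intertwine_gen (V := V) (W := unis l.+1 k)) x; rewrite ?unis_g ?unis_h.
- rewrite mulmx_suml mulmx_sumr; apply: eq_bigr => i _.
  have il : (i <= l)%N by rewrite -ltnS.
  rewrite [RHS]mulmxA weight_vb -[LHS]mulmxA fhX_weight ?leq_subr // subKn //.
  by rewrite -scalemxAr -scalemxAl.
(* The first term on the left vanishes by [fh], the last one on the right because v_(l+1) = 0; the
   remaining terms match after a shift of the index. *)
- rewrite mulmx_suml mulmx_sumr big_ord_recl [RHS]big_ord_recr /=.
  rewrite [X in _ = _ + X]mulmxA [X in _ = _ + X *m _]shift_vb //.
  rewrite [X in _ = _ + X *m _]vb_out // mul0mx addr0.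
  rewrite -!mulmxA -[V (h ^+ _) *m V h]hactXr subn0 fh mulmx0 add0r.
  apply: eq_bigr => i _; rewrite [RHS]mulmxA shift_vb // -!mulmxA -hactXr.
  by rewrite /bump /= add1n subnSK.
Qed.

Lemma unis_cohom_hom (v : 'cV_(hdim V)) : V g *m v = w ^+ k *: v ->
  V (h ^+ l.+1) *m v = 0 -> f *m V (h ^+ l) *m v = 1%:M ->
  unis_cohom *m unis_hom l.+1 v = 1%:M.
Proof.
move=> gv hv fv; apply: mx_vbP => b bl.
rewrite -mulmxA unis_hom_vb // mulmx_suml mul1mx (bigD1 (Ordinal bl)) //=.
(* For a < l, computing f h ^ a g v from both sides gives two weights whose ratio is a power of q
   with exponent strictly between - d and 0, so the value is 0. For a > l, [hv] applies. *)
have E a : f *m V (h ^+ a) *m v = (a == l)%:R%:M.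
  have [al | la | ->] := ltngtP a l; last by [].
  - have := fhX_weight (ltnW al) => /(congr1 (mulmx^~ v)).
    rewrite /= -mulmxA gv -scalemxAr -scalemxAl expr_s -scalerA.
    move/(scalerI (expf_neq0 _ (prim_root_neq0 (ltnW (tn_gt1 D)) wP))) => /eqP.
    rewrite -subr_eq0 -{1}[_ *m v]scale1r -scalerBl scaler_eq0 => /orP[|/eqP->].
      rewrite subr_eq0 eq_sym -(inj_eq invr_inj) invrK invr1 -(prim_order_dvd (tq_prim D)).
      by rewrite gtnNdvd ?subn_gt0 // (leq_ltn_trans (leq_subr _ _)).
    by rewrite [RHS]raddf0.
  - by rewrite -(subnK la) exprD rmorphM -[_ (h ^+ _) * _]/(_ *m _) -!mulmxA hv !mulmx0 raddf0.
have E2 i : (i <= l)%N -> vb K l.+1 i *m (f *m V (h ^+ (l - i))) *m (V (h ^+ b) *m v) =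
    vb K l.+1 i *m (i == b)%:R%:M.
  move=> il; rewrite -mulmxA.
  have -> : f *m V (h ^+ (l - i)) *m (V (h ^+ b) *m v) = f *m V (h ^+ (l - i + b)) *m v.
    by rewrite exprD rmorphM -[_ (h ^+ _) * _]/(_ *m _) !mulmxA.
  rewrite E; suff -> : (l - i + b == l)%N = (i == b) by [].
  by rewrite -[LHS](eqn_add2r i) addnAC subnK // eqn_add2l eq_sym.
rewrite E2 // eqxx mulmx1 big1 ?addr0 // => i; rewrite -val_eqE /= => /negPf ib.
by rewrite E2 ?leq_ord // ib raddf0 mulmx0.
Qed.
End Retract.
Lemma unis_summand (V : hmod) : (0 < hdim V)%N -> exists l k (V' : hmod),
  (l < td D)%N /\ hiso V (hsum (unis l.+1 k) V').
Proof.
move=> V0.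
have V1 : V (h ^+ 0) != 0.
  rewrite expr0 rmorph1; apply/eqP=> /matrixP/(_ (Ordinal V0) (Ordinal V0)).
  by rewrite !mxE eqxx => /eqP; rewrite oner_eq0.
have exl : exists l, V (h ^+ l) != 0 by exists 0%N.
have bnd l : V (h ^+ l) != 0 -> (l <= td D)%N.
  apply: contraR; rewrite -ltnNge => /ltnW/subnK <-.
  by rewrite exprD th_d mulr0 rmorph0.
have [l Vl lmax] := ex_maxnP exl bnd.
have Vl1 : V (h ^+ l.+1) = 0.
  by apply/eqP; apply: contraT => /lmax; rewrite ltnn.
have ld : (l < td D)%N.
  by rewrite ltn_neqAle bnd // andbT; apply: contraNneq Vl => ->; rewrite th_d rmorph0.
(* The projections sum to 1, so h ^ l is the sum of its blocks between weight spaces and some block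
   is nonzero. *)
have [a [b Eab]] : exists a b, V (weight_proj a) *m V (h ^+ l) *m V (weight_proj b) != 0.
  apply: contrapT => no; move/eqP: Vl; apply.
  rewrite -[V _]mul1mx -[_ *m _]mulmx1 -[1%:M](rmorph1 V) -sum_weight_proj raddf_sum /=.
  rewrite mulmx_suml mulmx_suml big1 // => a _; rewrite mulmx_sumr big1 // => b _.
  by apply: contrapT => /eqP ab; apply: no; exists a, b.
have /matrix0Pn[i [j Eij]] := Eab; set c := _ i j in Eij.
(* The row and column through a nonzero entry [c] of that block are weight vectors; dividing by [c]
   makes f (h ^ l v) = 1. *)
pose v := col j (V (weight_proj b)); pose f := c^-1 *: row i (V (weight_proj a)).
have fv : f *m V (h ^+ l) *m v = 1%:M.
  rewrite -!scalemxAl -row_mul [_ *m v](_ : _ = c%:M) ?scale_scalar_mx ?mulVf //.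
  apply/matrixP=> x y; rewrite !ord1 /c !mxE mulr1n.
  by apply: eq_bigr => z _; rewrite !mxE.
have gv : V g *m v = w ^+ b *: v.
  rewrite /v colE mulmxA.
  have <- : V (g * weight_proj b) = V g *m V (weight_proj b) by apply: rmorphM.
  by rewrite mul_g_weight_proj linearZ /= -scalemxAl.
have fg : f *m V g = w ^+ a *: f.
  rewrite -scalemxAl -row_mul scalerA mulrC -scalerA; congr (_ *: _).
  have <- : V (weight_proj a * g) = V (weight_proj a) *m V g by apply: rmorphM.
  by rewrite weight_proj_g linearZ /=; apply/rowP=> x; rewrite !mxE.
(* Moving g across h ^ l in f h ^ l g v forces the weight of [f] to be that of h ^ l v. *)
clearbody f v; have ab : w ^+ a = w ^+ (b + s * l).
  have L : f *m (V (h ^+ l) *m V g) *m v = (w ^+ b)%:M.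
    by rewrite -!mulmxA gv -!scalemxAr mulmxA fv scale_scalar_mx mulr1.
  have R : f *m (q ^+ l *: (V g *m V (h ^+ l))) *m v = (q ^+ l * w ^+ a)%:M.
    by rewrite -scalemxAr -scalemxAl mulmxA fg -!scalemxAl fv scalerA scale_scalar_mx mulr1.
  move: L; rewrite hXg R => /matrixP/(_ 0 0); rewrite !mxE eqxx !mulr1n => bl.
  by rewrite expr_s -bl mulrAC divff ?mul1r // expf_neq0 ?tq_neq0.
rewrite ab in fg.
have hv : V (h ^+ l.+1) *m v = 0 by rewrite Vl1 mul0mx.
have fh : f *m V (h ^+ l.+1) = 0 by rewrite Vl1 mulmx0.
have [|||V' VV'] := @hiso_sum_compl _ _ V (unis l.+1 b) (unis_cohom l f) (unis_hom l.+1 v).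
- exact: (unis_cohom_hom ld fg gv hv fv).
- exact: unis_cohomP.
- by move=> x; apply: unis_homP.
by exists l, b, V'.
Qed.

Local Notation U l k := (gcl (unis l k)).

(** A zero-dimensional module is isomorphic to its double, so its class cancels. *)
Lemma gcl_dim0 (V : hmod) : hdim V = 0%N -> gcl V = 0.
Proof.
move=> V0; apply: (addIr (gcl V)); rewrite add0r -gcl_sum; apply: gcl_iso.
have rows0 m p (A B : 'M[K]_(m, p)) : m = 0%N -> A = B.
  by move=> m0; apply/matrixP=> -[i im]; exfalso; rewrite m0 in im.
by exists 0, 0; split=> [||x]; apply: rows0; rewrite /= V0.
Qed.

(** The classes of the M(l, k) with 0 < l <= d generate the additive group: induction on the
    dimension, splitting off one summand by [unis_summand]. *)
Lemma green_span_ind (P : green_ring D -> Prop) :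
    (forall l k, (0 < l <= td D)%N -> P (U l k)) -> P 0 ->
    (forall x y, P x -> P y -> P (x + y)) -> (forall x, P x -> P (- x)) ->
  forall x, P x.
Proof.
move=> PU P0 PD PN; elim/green_ind=> // V.
have [m] := ubnP (hdim V); elim: m V => // m IH V Vm.
have [V0 | V0] := posnP (hdim V); first by rewrite gcl_dim0.
have [l [k [V' [ld VV']]]] := unis_summand V0.
rewrite (gcl_iso VV') gcl_sum; apply: PD; first exact: PU.
by apply: IH; move: Vm; rewrite (hiso_dim VV') /= addSn ltnS; apply/leq_trans/leq_addl.
Qed.

End StructureTheorem.

(** * Products in the Green ring *)

Section TensorRelations.
Variables (K : fieldType) (D : taft_datum K).
Local Notation H := (taft D).
Local Notation hmod := (hmod H).
Local Notation q := (tq D).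
Local Notation g := (tg D).
Local Notation h := (th D).
Local Notation n := (tn D).
Local Notation d := (td D).

Variables (w : K) (s : nat).
Hypotheses (wP : n.-primitive_root w) (ws : w ^+ s = q^-1).
Local Notation unis := (unis wP ws).
Local Notation U l k := (gcl (unis l k)).

(** The equality [m = p] is propositional because the dimension of a tensor product is a product,
    which is only provably the sum l1 + l2 of the lengths of two summands. *)
Lemma mx_right_inv m p (A : 'M[K]_(m, p)) : m = p ->
  (forall i : 'I_m, exists c, A *m c = vb K m i) ->
  exists B, A *m B = 1%:M /\ B *m A = 1%:M.
Proof.
move=> mp; case: _ / mp A => A /fin_all_exists[c Ac].
have AB : A *m (\matrix_(i, j) c j i 0) = 1%:M.
  apply: mx_vbP => b bm; rewrite mul1mx -mulmxA [RHS](esym (Ac (Ordinal bm))); congr (_ *m _).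
  by rewrite (mul_vb _ (Ordinal bm)); apply/colP=> i; rewrite !mxE.
by exists (\matrix_(i, j) c j i 0); split=> //; apply: mulmx1C.
Qed.

(** Criterion for a decomposition: [v1] and [v2] define a map from the direct sum of M(l1, k1) and
    M(l2, k2) to [V]. It is onto if they generate [V], which the condition on all [S] expresses, and
    then bijective by dimension. *)
Lemma gcl_unis_sum (V : hmod) l1 k1 v1 l2 k2 v2 : (l1 <= d)%N -> (l2 <= d)%N ->
    V g *m v1 = w ^+ k1 *: v1 -> V g *m v2 = w ^+ k2 *: v2 ->
    V (h ^+ l1) *m v1 = 0 -> V (h ^+ l2) *m v2 = 0 -> hdim V = (l1 + l2)%N ->
    (forall S : 'cV_(hdim V) -> Prop, (forall c u v, S u -> S v -> S (c *: u + v)) ->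
       (forall b, S (V (h ^+ b) *m v1)) -> (forall b, S (V (h ^+ b) *m v2)) ->
     forall i : 'I_(hdim V), S (vb K _ i)) ->
  gcl V = U l1 k1 + U l2 k2.
Proof.
move=> l1d l2d gv1 gv2 hv1 hv2 dV span.
rewrite -gcl_sum; apply/esym/gcl_iso.
pose P := row_mx (unis_hom l1 v1) (unis_hom l2 v2).
have [i|Q [PQ QP]] := mx_right_inv (A := P) dV.
  apply: (span (fun u => exists c, P *m c = u)) i => [a u v [c <-] [c' <-] | b | b].
  - by exists (a *: c + c'); rewrite mulmxDr -scalemxAr.
  - by exists (col_mx (vb K l1 b) 0); rewrite mul_row_col mulmx0 addr0 unis_hom_vb.
  - by exists (col_mx 0 (vb K l2 b)); rewrite mul_row_col mulmx0 add0r unis_hom_vb.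
exists P, Q; split=> // x.
by rewrite mul_mx_row mul_row_block !mulmx0 addr0 add0r /= !(unis_homP wP ws (V := V)).
Qed.

Section TensorBasis.
Variables (l k : nat) (V : hmod).
Hypothesis ld : (l <= d)%N.
Local Notation W := (ttens (unis l k) V).

Definition tv a (v : 'cV[K]_(hdim V)) : 'cV_(hdim W) := vb K l a *t v.

Lemma tvZ a c v : tv a (c *: v) = c *: tv a v.
Proof. exact: (tensmxZr c (vb K l a) v). Qed.

Lemma tv_out a v : (l <= a)%N -> tv a v = 0.
Proof. by move=> la; rewrite /tv vb_out //; apply/matrixP=> i j; rewrite !mxE mul0r. Qed.

Lemma tv0 a : tv a 0 = 0.
Proof. by apply/matrixP=> i j; rewrite !mxE mulr0. Qed.

Lemma tv_g a v : W g *m tv a v = w ^+ (k + s * a) *: tv a (V g *m v).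
Proof.
rewrite ttens_g [LHS](tensmx_mul (unis l k g) (V g) (vb K l a) v).
by rewrite unis_g weight_vb [LHS]tensmxZl.
Qed.

Lemma tv_h a v : W h *m tv a v = tv a (V h *m v) + tv a.+1 (V g *m v).
Proof.
rewrite ttens_h mulmxDl; congr (_ + _).
  by rewrite [LHS](tensmx_mul 1%:M (V h) (vb K l a) v) mul1mx.
by rewrite [LHS](tensmx_mul (unis l k h) (V g) (vb K l a) v) unis_h shift_vb.
Qed.

Lemma vb_tens (i : 'I_(hdim W)) : exists (a : 'I_l) (b : 'I_(hdim V)),
  vb K _ i = tv a (vb K _ b).
Proof.
case: (mxtens_indexP i) => a b; exists a, b; apply/colP=> j.
rewrite !mxE -natrM mulnb; congr (nat_of_bool _)%:R.
case: (mxtens_indexP j) => a' b'; rewrite !mxtens_indexK.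
by rewrite -[RHS]/((a', b') == (a, b)) -(can_eq (@mxtens_indexK _ _)).
Qed.
End TensorBasis.

Lemma gcl_unis1_mul k l i : (0 < l <= d)%N -> U 1 k * U l i = U l (k + i).
Proof.
case/andP=> l0 ld; rewrite gcl_tens.
have d1 : (1 <= d)%N := ltnW (td_gt1 D).
pose v := tv 1 k (V := unis l i) 0 (vb K l 0).
have hX b : ttens (unis 1 k) (unis l i) (h ^+ b) *m v = tv 1 k (V := unis l i) 0 (vb K l b).
  elim: b => [|b IH]; first by rewrite expr0 rmorph1 mul1mx.
  by rewrite hactX -mulmxA IH tv_h // (tv_out _ _ (leqnn 1)) addr0 unis_h shift_vb.
(* The zero module serves as second summand, so that [gcl_unis_sum] applies to a cyclic module. *)
have U0 : U 0 0 = 0 by apply: gcl_dim0.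
rewrite -[RHS]addr0 -U0; apply: (gcl_unis_sum (v1 := v) (v2 := 0)) => //.
- by rewrite tv_g unis_g weight_vb tvZ scalerA muln0 !addn0 -exprD.
- by rewrite mulmx0 scaler0.
- by rewrite hX vb_out // tv0.
- by rewrite mulmx0.
move=> S _ S1 _ j; have [a [b ->]] := vb_tens j.
by rewrite (ord1 a) -hX.
Qed.
(** The sum of the g-weights of the basis vectors of index b, ..., b + j - 1 of M(l, k). *)
Definition wsum k b j := \sum_(i < j) w ^+ (k + s * (b + i)).

Lemma wsum_recl k b j : wsum k b j.+1 = w ^+ (k + s * b) + wsum k b.+1 j.
Proof.
rewrite /wsum big_ord_recl addn0; congr (_ + _); apply: eq_bigr => i _.
by rewrite addnS addSn.
Qed.

(** Up to w ^ k this is the geometric sum of the powers of 1/q, which can vanish only if q ^ l =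
    1. *)
Lemma wsum_neq0 k l : (0 < l < d)%N -> wsum k 0 l != 0.
Proof.
case/andP=> l0 ld.
have -> : wsum k 0 l = w ^+ k * \sum_(i < l) q^-1 ^+ i.
  by rewrite mulr_sumr; apply: eq_bigr => i _; rewrite (expr_s ws) // exprVn add0n.
rewrite mulf_neq0 ?expf_neq0 ?(prim_root_neq0 (ltnW (tn_gt1 D)) wP) //.
apply/eqP=> S0; have := subrX1 q^-1 l.
rewrite S0 mulr0 => /eqP; rewrite subr_eq0 exprVn -(inj_eq invr_inj) invrK invr1.
rewrite -(prim_order_dvd (tq_prim D)); by rewrite gtnNdvd.
Qed.

Section TensorTwo.
Variables (l k : nat).
Hypothesis (ld : (l <= d)%N).
Local Notation W := (ttens (unis 2 0) (unis l k)).
Local Notation e a b := (tv 2 0 (V := unis l k) a (vb K l b)).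

Lemma e_h a b : W h *m e a b = e a b.+1 + w ^+ (k + s * b) *: e a.+1 b.
Proof. by rewrite tv_h ?td_gt1 // unis_h shift_vb // unis_g weight_vb tvZ. Qed.

Lemma e_g a b : W g *m e a b = w ^+ (k + s * (a + b)) *: e a b.
Proof.
by rewrite tv_g unis_g weight_vb tvZ scalerA -exprD add0n addnCA mulnDr.
Qed.

Lemma e_out a b : (l <= b)%N -> e a b = 0.
Proof. by move=> lb; rewrite vb_out // tv0. Qed.

Lemma e1_hX b j : W (h ^+ j) *m e 1 b = e 1 (b + j).
Proof.
elim: j => [|j IH]; first by rewrite expr0 rmorph1 mul1mx addn0.
by rewrite hactX -mulmxA IH e_h (tv_out _ _ (leqnn 2)) scaler0 addr0 addnS.
Qed.

(** Among the j applications of h, at most one moves the left factor, and it contributes the weight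
    of the current right factor. The predecessor is truncated only for b = j = 0, where [wsum] is
    0. *)
Lemma e0_hX b j : W (h ^+ j) *m e 0 b = e 0 (b + j) + wsum k b j *: e 1 (b + j).-1.
Proof.
elim: j => [|j IH].
  by rewrite expr0 rmorph1 mul1mx addn0 /wsum big_ord0 scale0r addr0.
rewrite hactX -mulmxA IH mulmxDr -scalemxAr !e_h (tv_out _ _ (leqnn 2)) scaler0 addr0.
rewrite /wsum big_ord_recr /= scalerDl addnS -addrA [X in _ = _ + X]addrC; congr (_ + (_ + _)).
case: j {IH} => [|j]; first by rewrite big_ord0 !scale0r.
by rewrite addnS.
Qed.

Lemma e_span (S : 'cV_(hdim W) -> Prop) : (forall b, S (e 0 b)) -> (forall b, S (e 1 b)) ->
  forall i : 'I_(hdim W), S (vb K _ i).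
Proof. by move=> S0 S1 i; have [[[|[|//]] a2] [b ->]] := vb_tens i. Qed.
End TensorTwo.

Lemma gcl_unis2_mul l k : (0 < l < d)%N ->
  U 2 0 * U l k = U l.+1 k + U l.-1 (k + s).
Proof.
case: l => // l /andP[_ ld]; rewrite gcl_tens.
pose e a b := tv 2 0 (V := unis l.+1 k) a (vb K l.+1 b).
have eo a b : (l < b)%N -> e a b = 0 by apply: e_out.
have c0 : wsum k 0 l.+1 != 0 by rewrite wsum_neq0.
(* The coefficient [w ^+ k - wsum k 0 l.+1] makes [h ^ l] kill the second vector. *)
have hv2 b : ttens (unis 2 0) (unis l.+1 k) (h ^+ b) *m
    (e 0%N 1%N + (w ^+ k - wsum k 0 l.+1) *: e 1%N 0%N) =
    e 0%N b.+1 + (wsum k 0 b.+1 - wsum k 0 l.+1) *: e 1%N b.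
  rewrite mulmxDr -scalemxAr e0_hX ?e1_hX // 1?ltnW // add1n add0n /=.
  rewrite -addrA -scalerDl; congr (_ + _ *: _).
  by rewrite [in RHS]wsum_recl muln0 addn0 addrA; congr (_ - _); rewrite addrC.
apply: (gcl_unis_sum (v1 := e 0%N 0%N) (v2 := e 0%N 1%N + (w ^+ k - wsum k 0 l.+1) *: e 1%N 0%N)).
- exact: ld.
- by rewrite (leq_trans (leq_pred _)) // ltnW.
- by rewrite e_g muln0 addn0.
- by rewrite mulmxDr -scalemxAr !e_g !muln1 scalerDr scalerA mulrC -scalerA.
- by rewrite e0_hX 1?ltnW // add0n -/(e _ _) -/(e 1%N _) !eo ?scaler0 ?addr0.
- by rewrite hv2 subrr scale0r addr0 eo.
- by rewrite /= mul2n -addnn addnS.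
move=> S SD S1 S2; have SZ c u : S u -> S (c *: u).
  move=> Su; have S0 : S 0 by have := SD (-1) u u Su Su; rewrite scaleN1r addNr.
  by rewrite -[_ *: u]addr0; apply: SD.
(* Subtracting h ^ b of the second generator from h ^ (b + 1) of the first leaves
   [wsum k 0 l.+1 *: e 1 b], with a nonzero coefficient because l + 1 < d. *)
have Se1 b : S (e 1%N b).
  rewrite -[e _ _]scale1r -(mulVf c0) -scalerA; apply: SZ.
  have := SD (-1) _ _ (S2 b) (S1 b.+1); rewrite hv2 e0_hX 1?ltnW // add0n /=.
  rewrite scaleN1r opprD addrACA addNr add0r -scaleNr -scalerDl.
  by rewrite opprB subrK.
apply: e_span => //; case=> [|b].
  by have := S1 0%N; rewrite expr0 rmorph1 mul1mx.
have := SD (- wsum k 0 b.+1) _ _ (Se1 b) (S1 b.+1).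
by rewrite e0_hX 1?ltnW // add0n /= addrCA -scalerDl addNr scale0r addr0.
Qed.

(** At l = d the sum [wsum k 0 d] is zero, so the splitting changes: [e 0 0] and [e 1 0] both
    generate modules of length d, as h ^ d = 0. *)
Lemma gcl_unis2_mul_top k : U 2 0 * U d k = U d k + U d (k + s).
Proof.
rewrite gcl_tens; pose e a b := tv 2 0 (V := unis d k) a (vb K d b).
apply: (gcl_unis_sum (v1 := e 0%N 0%N) (v2 := e 1%N 0%N)) => //.
- by rewrite e_g muln0 addn0.
- by rewrite e_g muln1.
- by rewrite th_d rmorph0 mul0mx.
- by rewrite th_d rmorph0 mul0mx.
- by rewrite /= mul2n addnn.
move=> S SD S1 S2; have Se1 b : S (e 1%N b) by have := S2 b; rewrite e1_hX.
apply: e_span => // b.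
have := SD (- wsum k 0 b) _ _ (Se1 b.-1) (S1 b).
by rewrite e0_hX // add0n addrCA -scalerDl addNr scale0r addr0.
Qed.
End TensorRelations.

(** * Generators and commutativity of the Green ring *)

Section GreenGenerators.
Variables (K : fieldType) (D : taft_datum K).
Local Notation hmod := (hmod (taft D)).
Local Notation q := (tq D).
Local Notation g := (tg D).
Local Notation h := (th D).
Local Notation n := (tn D).
Local Notation d := (td D).

Variables (w : K) (s : nat).
Hypotheses (wP : n.-primitive_root w) (ws : w ^+ s = q^-1).
Local Notation unis := (unis wP ws).
Local Notation U l k := (gcl (unis l k)).

Lemma gcl_unis0 k : U 0 k = 0.
Proof. exact: gcl_dim0. Qed.

Lemma gcl_unis1_eq1 k : w ^+ k = 1 -> U 1 k = 1.
Proof.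
move=> wk; apply: gcl_iso; exists 1%:M, 1%:M; split; rewrite ?[1%:M *m 1%:M]mulmx1 //.
apply: (intertwine_gen (V := unis 1 k) (W := triv D)); rewrite mul1mx mulmx1.
- rewrite unis_g /= /triv_act counit_g; apply/matrixP=> i j.
  by rewrite !ord1 !mxE muln0 addn0 wk.
- rewrite unis_h /= /triv_act counit_h; apply/matrixP=> i j.
  by rewrite !ord1 !mxE andbF mul0rn.
Qed.

Lemma gcl_unis1 k : U 1 k = U 1 1 ^+ k.
Proof.
elim: k => [|k IH]; first by rewrite gcl_unis1_eq1.
by rewrite exprS -IH gcl_unis1_mul ?add1n // (ltnW (td_gt1 D)).
Qed.

Lemma gcl_unis1_Xn : U 1 1 ^+ n = 1.
Proof. by rewrite -gcl_unis1 gcl_unis1_eq1 // (prim_expr_order wP). Qed.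

(** [gcl_unis2_mul], solved for its longest term, expresses M(l + 2, k) through shorter modules. The
    unit is reached as Y ^ n. *)
Lemma green_gen_ind (P : green_ring D -> Prop) : P (U 1 1) -> P (U 2 0) ->
    (forall x y, P x -> P y -> P (x + y)) -> (forall x, P x -> P (- x)) ->
    (forall x y, P x -> P y -> P (x * y)) ->
  forall x, P x.
Proof.
move=> PY PZ PD PN PM.
have PX x k : P x -> P (x ^+ k.+1).
  by move=> Px; elim: k => [|k IH] //; rewrite exprS; apply: PM.
have P1 : P 1.
  by rewrite -gcl_unis1_Xn -(prednK (ltnW (tn_gt1 D))); apply: PX.
have P0 : P 0 by rewrite -(subrr 1); apply/PD/PN.
apply: (@green_span_ind _ _ _ _ wP ws P) => // l k /andP[_]; elim/ltn_ind: l k => -[|[|l]] IH k ld.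
- by rewrite gcl_unis0.
- by rewrite gcl_unis1; case: k => // k; apply: PX.
have := gcl_unis2_mul wP ws k (ld : (0 < l.+1 < d)%N) => /eqP.
rewrite -subr_eq => /eqP <-; apply: PD; last apply: PN.
  by apply: PM => //; apply: IH => //; apply: ltnW.
by apply: IH => //=; apply/ltnW/ltnW.
Qed.

(** YZ and ZY are both the class of M(2, 1); the centralizer of an element is a subring, so it is
    everything once it contains Y and Z. *)
Lemma green_mulC (x y : green_ring D) : x * y = y * x.
Proof.
have centr (z : green_ring D) : z * U 1 1 = U 1 1 * z -> z * U 2 0 = U 2 0 * z ->
    forall x, z * x = x * z.
  move=> zY zZ; apply: green_gen_ind => // [a b za zb | a za | a b za zb].
  - by rewrite mulrDl mulrDr za zb.
  - by rewrite mulrN mulNr za.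
  - by rewrite mulrA za -mulrA zb mulrA.
have YZ : U 1 1 * U 2 0 = U 2 0 * U 1 1.
  rewrite gcl_unis1_mul ?td_gt1 // addn0 gcl_unis2_mul ?td_gt1 //.
  by rewrite gcl_unis0 addr0.
by apply: (centr x); symmetry; apply: (centr _).
Qed.

End GreenGenerators.

(* The Dickson polynomial of the second kind, shifted: [dickson t l] has       *)
(* degree [l - 1].                                                            *)
Fixpoint dickson (C : comNzRingType) (t : C) l : {poly C} :=
  match l with
  | 0 => 0
  | l1.+1 => match l1 with
             | 0 => 1
             | l2.+1 => 'X * dickson t l1 - t *: dickson t l2
             end
  end.

Arguments dickson : simpl never.

Lemma dicksonS (C : comNzRingType) (t : C) l :
  dickson t l.+2 = 'X * dickson t l.+1 - t *: dickson t l.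
Proof. by []. Qed.

(** * Characters of the Green algebra *)

Section Characters.
Variables (K : fieldType) (D : taft_datum K).
Local Notation hmod := (hmod (taft D)).
Local Notation q := (tq D).
Local Notation g := (tg D).
Local Notation h := (th D).
Local Notation n := (tn D).
Local Notation d := (td D).

Variables (w : K) (s : nat).
Hypotheses (wP : n.-primitive_root w) (ws : w ^+ s = q^-1).
Local Notation unis := (unis wP ws).
Local Notation U l k := (gcl (unis l k)).

(** The dimension of the image under h ^ j of a weight space: an additive isomorphism invariant,
    hence defined on the Green ring. *)
Definition weight_rank (V : hmod) j i := \rank (V (h ^+ j * weight_proj D w i)).

Lemma weight_rank_iso V W j i : hiso V W -> weight_rank V j i = weight_rank W j i.
Proof.
move=> [P [Q [PQ QP PV]]]; pose x := h ^+ j * weight_proj D w i.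
have WE : W x = P *m V x *m Q by rewrite PV -mulmxA PQ mulmx1.
have VE : V x = Q *m W x *m P by rewrite -mulmxA -PV mulmxA QP mul1mx.
apply/eqP; rewrite eqn_leq; apply/andP; split.
  by rewrite /weight_rank -/x VE (leq_trans (mxrankM_maxl _ _)) ?mxrankM_maxr.
by rewrite /weight_rank -/x WE (leq_trans (mxrankM_maxl _ _)) ?mxrankM_maxr.
Qed.

Lemma weight_rank_sum V W j i :
  weight_rank (hsum V W) j i = (weight_rank V j i + weight_rank W j i)%N.
Proof. exact: rank_diag_block_mx. Qed.

Lemma weight_proj_weight (V : hmod) (v : 'cV_(hdim V)) k i : V g *m v = w ^+ k *: v ->
  V (weight_proj D w i) *m v = (w ^+ k == w ^+ i)%:R *: v.
Proof.
move=> gv; have gX a : V (g ^+ a) *m v = (w ^+ k) ^+ a *: v.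
  elim: a => [|a IH]; first by rewrite expr0 rmorph1 mul1mx scale1r.
  by rewrite hactX -mulmxA IH -scalemxAr gv scalerA -exprSr.
rewrite /weight_proj linearZ /= raddf_sum -scalemxAl mulmx_suml.
have wi0 : w ^+ i != 0 by rewrite expf_neq0 // (prim_root_neq0 (ltnW (tn_gt1 D)) wP).
have -> : \sum_(a < n) V (w ^- (i * a) *: g ^+ a) *m v = (n * (w ^+ k == w ^+ i))%:R *: v.
  have -> : (w ^+ k == w ^+ i) = (w ^+ k / w ^+ i == 1).
    by rewrite -[RHS](inj_eq (mulIf wi0)) divfK // mul1r.
  rewrite -sum_root_unity; last first.
    by rewrite exprMn exprVn ![w ^+ _ ^+ n]exprAC (prim_expr_order wP) !expr1n invr1 mulr1.
  rewrite scaler_suml; apply: eq_bigr => a _.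
  by rewrite linearZ /= -scalemxAl gX scalerA (exprM w i) exprMn exprVn mulrC.
by rewrite scalerA natrM mulrA mulVf ?mul1r // (nK0 wP).
Qed.

(** The sum counts the basis vectors of weight w ^ i that survive h ^ j. There is at most one, so
    the operator is either an elementary matrix or zero. *)
Lemma weight_rank_unis l k j i : (l <= d)%N ->
  weight_rank (unis l k) j i =
  (\sum_(b < l) ((b + j < l) && (w ^+ (k + s * b) == w ^+ i)%R))%N.
Proof.
move=> ld; pose F b := ((b + j < l)%N && (w ^+ (k + s * b) == w ^+ i)).
have E b : unis l k (h ^+ j * weight_proj D w i) *m vb K l b =
    (w ^+ (k + s * b) == w ^+ i)%:R *: vb K l (b + j).
  rewrite rmorphM -mulmxA (weight_proj_weight (V := unis l k) (k := k + s * b)).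
    by rewrite -scalemxAr unis_hX.
  by rewrite unis_g weight_vb.
(* The weights along M(l, k) are distinct because q has order d and l <= d. *)
have uniqF b b' : (b < l)%N -> (b' < l)%N -> F b -> F b' -> b = b'.
  move=> bl bl' /andP[_ /eqP Eb] /andP[_ /eqP]; rewrite -Eb !(expr_s ws).
  move/(mulfI (expf_neq0 _ (prim_root_neq0 (ltnW (tn_gt1 D)) wP)))/invr_inj/eqP.
  by rewrite (eq_prim_root_expr (tq_prim D)) !modn_small ?(leq_trans _ ld) // => /eqP.
have [[b bl /= Fb] | no] := pselect (exists2 b, (b < l)%N & F b).
  rewrite (bigD1 (Ordinal bl)) //= -/(F b) Fb big1 => [|c cb]; last first.
    rewrite [X in nat_of_bool X](_ : _ = false) //; apply: contraNF cb => Fc.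
    by apply/eqP/val_inj/(uniqF _ _ (ltn_ord c) bl).
  have /andP[bj wb] := Fb; have bl' : (b + j < l)%N := bj.
  rewrite /weight_rank.
  suff -> : unis l k (h ^+ j * weight_proj D w i) = delta_mx (Ordinal bl') (Ordinal bl).
    by rewrite mxrank_delta.
  apply: mx_vbP => c cl; rewrite E (mul_vb _ (Ordinal cl)).
  apply/colP=> x; rewrite !mxE -natrM mulnb; congr (nat_of_bool _)%:R.
  rewrite -!val_eqE /=; have [->|cb] := eqVneq c b; first by rewrite wb andbT.
  rewrite andbF; apply: contraNF cb => /andP[wc /eqP xc]; apply/eqP/uniqF => //.
  by rewrite /F -xc ltn_ord.
rewrite big1 => [|b _]; last first.
  by rewrite [X in nat_of_bool X](_ : _ = false) //; apply/negP => Fb; apply: no; exists b.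
apply/eqP; rewrite mxrank_eq0; apply/eqP/mx_vbP => b bl.
rewrite E mul0mx; have [wb|] := eqVneq; last by rewrite scale0r.
rewrite vb_out ?scaler0 // leqNgt; apply/negP=> bj; apply: no; exists b => //.
by rewrite /F bj wb eqxx.
Qed.

Variables (C : comNzRingType) (y z : C).
Hypothesis yn : y ^+ n = 1.
Local Notation t := (y ^+ s).
Local Notation F l := (dickson t l).[z].

(* In [unis l k] the vector of weight [w ^+ (k + s * b)] survives exactly      *)
(* [l - 1 - b] applications of [h]; the coefficients are chosen so that        *)
(* [char_gen (unis l k)] telescopes to [y ^+ k * F l].                         *)
Definition char_gen (V : hmod) : C :=
  \sum_(i < n) y ^+ i * \sum_(j < d)
    (F j.+1 - t * F j) * ((weight_rank V j i)%:R - (weight_rank V j.+1 i)%:R).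

Lemma char_gen_iso V W : hiso V W -> char_gen V = char_gen W.
Proof.
move=> VW; apply: eq_bigr => i _; congr (_ * _); apply: eq_bigr => j _.
by rewrite !(weight_rank_iso _ _ VW).
Qed.

Lemma char_gen_sum V W : char_gen (hsum V W) = char_gen V + char_gen W.
Proof.
rewrite -big_split; apply: eq_bigr => i _ /=; rewrite -mulrDr -big_split; congr (_ * _).
apply: eq_bigr => j _ /=; rewrite -mulrDr; congr (_ * _).
by rewrite !weight_rank_sum !natrD opprD addrACA.
Qed.

(** The weight w ^ a knows a only modulo n, which suffices since y ^ n = 1. *)
Lemma y_weight a : \sum_(i < n) y ^+ i * (w ^+ a == w ^+ i)%:R = y ^+ a.
Proof.
have n0 : (0 < n)%N := ltnW (tn_gt1 D).
rewrite (bigD1 (Ordinal (ltn_pmod a n0))) //= big1 => [|i].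
  rewrite (eq_prim_root_expr wP) modn_mod eqxx mulr1 addr0.
  by rewrite {2}(divn_eq a n) exprD mulnC exprM yn expr1n mul1r.
rewrite -val_eqE /= (eq_prim_root_expr wP) (modn_small (ltn_ord i)) eq_sym => /negPf->.
by rewrite mulr0.
Qed.

Lemma char_gen_unis l k : (l <= d)%N -> char_gen (unis l k) = y ^+ k * F l.
Proof.
move=> ld.
have E i : \sum_(j < d) (F j.+1 - t * F j) *
      ((weight_rank (unis l k) j i)%:R - (weight_rank (unis l k) j.+1 i)%:R) =
    \sum_(b < l) (w ^+ (k + s * b) == w ^+ i)%:R * (F (l - b) - t * F (l - b.+1)).
  under eq_bigr => j _ do rewrite !weight_rank_unis // !natr_sum -sumrB mulr_sumr.
  rewrite exchange_big /=; apply: eq_bigr => b _.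
  (* The ranks for j and j + 1 differ on the vector of index b only at j = l - 1 - b. *)
  have bd : (l - b.+1 < d)%N by rewrite (leq_trans _ ld) // ltn_subrL (leq_ltn_trans _ (ltn_ord b)).
  rewrite (bigD1 (Ordinal bd)) //= big1 ?addr0 => [|j].
    rewrite addnS -addSn subnKC ?ltn_ord // ltnn /= subr0 mulrC.
    by rewrite leqnn subnSK.
  rewrite -val_eqE /= => jb; suff -> : (b + j < l)%N = (b + j.+1 < l)%N by rewrite subrr mulr0.
  rewrite addnS [RHS]ltn_neqAle; case: (ltnP (b + j) l) => _; rewrite ?andbF // andbT.
  by apply/esym/negP=> /eqP El; move: jb; rewrite -[X in (X - _)%N]El -addSn addKn eqxx.
rewrite /char_gen; under eq_bigr => i _ do rewrite E mulr_sumr.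
rewrite exchange_big /=.
transitivity (\sum_(b < l) (y ^+ k * (t ^+ b * F (l - b)) - y ^+ k * (t ^+ b.+1 * F (l - b.+1)))).
  apply: eq_bigr => b _; under eq_bigr => i _ do rewrite mulrA.
  rewrite -mulr_suml y_weight exprD (exprM y s) mulrBr exprSr !mulrA; congr (_ - _).
have := telescope_sumr (fun b => y ^+ k * (t ^+ b * F (l - b))) (leq0n l).
rewrite big_mkord => T; rewrite -[LHS]opprK -sumrN.
under eq_bigr => b _ do rewrite opprB.
by rewrite T subnn hornerC !mulr0 sub0r opprK expr0 mul1r subn0.
Qed.

Hypothesis top_rel : z * F d = (1 + t) * F d.

(** Multiplicativity is checked for a left factor Y or Z against M(l, k). For Z it is the recurrence
    of [dickson] when l < d, and [top_rel] when l = d. *)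
Lemma green_char : exists chi : green_ring D -> C,
  [/\ zmod_morphism chi, monoid_morphism chi, chi (U 1 1) = y & chi (U 2 0) = z].
Proof.
have rel := green_liftP char_gen_iso char_gen_sum.
pose chi : green_ring D -> C := @zlift _ (@green_rel K D) C char_gen.
have chiB : zmod_morphism chi := zlift_is_additive rel.
have chi0 := zmm0 chiB; have chiN := zmmN chiB; have chiD := zmmD chiB.
have chiU l k : (l <= d)%N -> chi (U l k) = y ^+ k * F l.
  by move=> ld; rewrite [LHS](zlift_gen rel) char_gen_unis.
have d0 : (0 < d)%N := ltnW (td_gt1 D).
have F1 : F 1 = 1 by rewrite hornerC.
have chiY : chi (U 1 1) = y by rewrite chiU // F1 mulr1.
have chiZ : chi (U 2 0) = z.
  by rewrite chiU ?td_gt1 // mul1r dicksonS scaler0 subr0 mulr1 hornerX.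
exists chi; split=> //; split; last first.
  suff M x : forall x', chi (x * x') = chi x * chi x' by move=> x x'; apply: M.
  apply: (@green_gen_ind _ _ _ _ wP ws (fun x => forall x', chi (x * x') = chi x * chi x')) x
    => [||x x' Mx Mx' b|x Mx b|x x' Mx Mx' b].
  - apply: (@green_span_ind _ _ _ _ wP ws) => [l k lP||b c Mb Mc|b Mb].
    + have /andP[_ ld] := lP.
      by rewrite gcl_unis1_mul // !chiU // F1 mulr1 mulrA -exprS.
    + by rewrite mulr0 chi0 mulr0.
    + by rewrite mulrDr !chiD Mb Mc mulrDr.
    + by rewrite mulrN !chiN Mb mulrN.
  - apply: (@green_span_ind _ _ _ _ wP ws) => [l k /andP[l0 ld]||b c Mb Mc|b Mb].
    + rewrite chiZ chiU //; case: ltngtP ld => // [ld|->] _; last first.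
        rewrite gcl_unis2_mul_top chiD !chiU // exprD -mulrA -mulrDr.
        by rewrite mulrCA top_rel mulrDl mul1r.
      rewrite gcl_unis2_mul ?l0 // chiD !chiU //; last by rewrite (leq_trans (leq_pred l)) // ltnW.
      case: l l0 ld => // l _ ld; rewrite dicksonS hornerD hornerN hornerM hornerX hornerZ /=.
      by rewrite exprD -mulrA -mulrDr subrK mulrCA.
    + by rewrite mulr0 chi0 mulr0.
    + by rewrite mulrDr !chiD Mb Mc mulrDr.
    + by rewrite mulrN !chiN Mb mulrN.
  - by rewrite mulrDl !chiD Mx Mx' mulrDl.
  - by rewrite mulNr !chiN Mx mulNr.
  - by rewrite -mulrA Mx Mx' Mx mulrA.
by rewrite -(gcl_unis1_eq1 wP ws (k := 0)) // chiU // F1 mulr1.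
Qed.

Lemma green_algebra_char : exists psi : green_algebra C D -> C,
  [/\ zmod_morphism psi, monoid_morphism psi, forall c, psi c%:A = c,
     psi (ga_tens 1 (U 1 1)) = y & psi (ga_tens 1 (U 2 0)) = z].
Proof.
have [chi [chiB [chi1 chiM] chiY chiZ]] := green_char.
have chiD := zmmD chiB; have chiN := zmmN chiB.
pose gen (p : zmodule C * zmodule (green_ring D)) : C := (p.1 : C) * chi p.2.
have rel (s' t' : zterm (zmodule C * zmodule (green_ring D))) :
    tens_rel s' t' -> zeval gen s' = zeval gen t'.
  apply: tens_liftP => *; rewrite /gen /=.
  - by rewrite mulrDl.
  - by rewrite chiD mulrDr.
  - rewrite !scalezrE mulrzAl -mulrzAr; congr (_ * _).
    pose chiA : {additive green_ring D -> C} :=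
      HB.pack chi (GRing.isZmodMorphism.Build _ _ chi chiB).
    exact: esym (raddfMz chiA _ _).
pose psi : green_algebra C D -> C :=
  @zlift _ (@tens_rel _ (zmodule C) (zmodule (green_ring D))) C gen.
have psiB : zmod_morphism psi := zlift_is_additive rel.
have psi0 := zmm0 psiB; have psiN := zmmN psiB; have psiD := zmmD psiB.
have psiE c x : psi (ga_tens c x) = c * chi x by apply: (zlift_gen rel).
exists psi; split=> //; first last.
- by rewrite psiE mul1r.
- by rewrite psiE mul1r.
- move=> c; have -> : c%:A = ga_tens c 1 :> green_algebra C D.
    by rewrite -[LHS]/(ga_scale c (ga_tens 1 1)) ga_scale_tens mulr1.
  by rewrite psiE chi1 mulr1.
split; first by rewrite psiE chi1 mulr1.
move=> x x'; elim/tens_ind: x => [a b||x1 x2 IH1 IH2|x IH].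
- elim/tens_ind: x' => [a' b'||x1 x2 IH1 IH2|x IH].
  + by rewrite tmk_mul !psiE chiM mulrACA.
  + by rewrite mulr0 psi0 mulr0.
  + by rewrite mulrDr !psiD IH1 IH2 mulrDr.
  + by rewrite mulrN !psiN IH mulrN.
- by rewrite mul0r psi0 mul0r.
- by rewrite mulrDl !psiD IH1 IH2 mulrDl.
- by rewrite mulNr !psiN IH mulNr.
Qed.
End Characters.

(** * Irreducible modules *)

Section CommutativeIrreducible.
Variables (C : fieldType) (A : algType C).

(** A copy of [C] indexed by [psi], so that each character carries its own [A]-module structure. *)
Definition char_mod (psi : {rmorphism A -> C}) : Type := C.

Section CharacterModule.
Variable psi : {rmorphism A -> C}.
Local Notation char_mod := (char_mod psi).

HB.instance Definition _ := GRing.Zmodule.on char_mod.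

Definition char_scale (a : A) (v : char_mod) : char_mod := (psi a * v : C).

Let scaleA a b v : char_scale a (char_scale b v) = char_scale (a * b) v.
Proof. by rewrite /char_scale rmorphM mulrA. Qed.
Let scale1 : left_id 1 char_scale.
Proof. by move=> v; rewrite /char_scale rmorph1 mul1r. Qed.
Let scaleDr : right_distributive char_scale +%R.
Proof. by move=> a u v; apply: mulrDr. Qed.
Let scaleDl v : {morph char_scale^~ v : a b / a + b}.
Proof. by move=> a b; rewrite /char_scale rmorphD mulrDl. Qed.

HB.instance Definition _ :=
  GRing.Zmodule_isLmodule.Build A char_mod scaleA scale1 scaleDr scaleDl.

Lemma char_modE a (v : char_mod) : a *: v = (psi a * (v : C) : C).
Proof. by []. Qed.

Hypothesis psiC : forall c, psi c%:A = c.

Lemma char_mod_irr : irreducible_mod char_mod.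
Proof.
split=> [|S [S0 Sl]]; first by exists (1 : C); apply: oner_neq0.
have [[v Sv v0] | no] := pselect (exists2 v, v \in S & v != 0); last first.
  left=> v; apply/idP/eqP => [Sv | -> //].
  by apply: contrapT => /eqP v0; apply: no; exists v.
right=> u; have := Sl ((u : C) / (v : C))%:A v 0 Sv S0.
rewrite addr0 char_modE psiC divfK // => ->.
Qed.
End CharacterModule.

Lemma char_mod_iso (psi1 psi2 : {rmorphism A -> C}) :
    (forall c, psi1 c%:A = c) -> (forall c, psi2 c%:A = c) ->
  mod_iso (char_mod psi1) (char_mod psi2) -> psi1 =1 psi2.
Proof.
move=> psi1C psi2C [f [f' fK f'K]] a; pose e : char_mod psi1 := (1 : C).
have fe : (f e : C) != 0.
  apply/eqP=> fe; have := fK e; have := fK 0; rewrite linear0 fe => -> /eqP.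
  by rewrite eq_sym; apply/negP/oner_neq0.
have E : a *: e = (psi1 a)%:A *: e by rewrite !char_modE psi1C.
have /(congr1 (fun x => x : C)) := congr1 f E.
rewrite (linearZZ f a e) (linearZZ f _ e) /= !char_modE psi2C.
by move/(mulIf fe).
Qed.

Section Irreducible.
Variable V : lmodType A.
Hypotheses (Virr : irreducible_mod V) (Acomm : forall a b : A, a * b = b * a).

(** Schur's argument: by commutativity the kernel of a - c is a submodule. If it is everything, a
    acts by c; if it is zero, the factor a - c can be cancelled from the product. *)
Lemma irr_eigenvalue (a : A) (r : seq C) :
    (forall v : V, (\prod_(c <- r) (a - c%:A)) *: v = 0) ->
  exists2 c, c \in r & forall v : V, a *: v = c%:A *: v.
Proof.
have [[v0 v00] Vsub] := Virr.
elim: r => [|c r IH] rV; first by have /eqP := rV v0; rewrite big_nil scale1r (negPf v00).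
pose S : {pred V} := [pred v | (a - c%:A) *: v == 0].
have Sm : submod_closed S.
  split=> [|b u v]; rewrite !inE ?scaler0 // => /eqP u0 /eqP v0'.
  by rewrite scalerDr v0' addr0 scalerA Acomm -scalerA u0 scaler0.
case: (Vsub S Sm) => SE.
  have [|c' c'r c'V] := IH.
    move=> v; apply/eqP; rewrite -[_ == 0](SE (_ *: v)) inE scalerA.
    by have := rV v; rewrite big_cons => ->.
  by exists c'; rewrite // inE c'r orbT.
exists c => [|v]; first exact: mem_head.
by have := SE v; rewrite !inE scalerBl subr_eq0 => /eqP.
Qed.

Hypothesis scalar_act : forall a : A, exists c : C, forall v : V, a *: v = c%:A *: v.

(** As [A] acts by scalars of [C], the [C]-line through [v0] is a nonzero submodule, hence all of
    [V]. *)
Lemma irr_cyclic (v0 : V) : v0 != 0 -> forall w, exists! c : C, w = c%:A *: v0.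
Proof.
move=> v00 w; pose S : {pred V} := [pred v | `[< exists c : C, v = c%:A *: v0 >]].
have Sm : submod_closed S.
  split=> [|b u v]; rewrite !inE.
    by apply/asboolP; exists 0; rewrite !scale0r.
  move=> /asboolP[c ->] /asboolP[c' ->]; apply/asboolP.
  have [cb Eb] := scalar_act b; exists (cb * c + c').
  by rewrite Eb scalerA -scalerDl -scalerAl mul1r scalerA -scalerDl.
have [_ /(_ S Sm) [] SE] := Virr.
  have := SE v0; rewrite !inE (negPf v00); case: asboolP => // -[].
  by exists 1; rewrite !scale1r.
have := SE w; rewrite !inE => /asboolP[c ->]; exists c; split=> // c' /eqP.
rewrite -subr_eq0 -scalerBl -scalerBl => /eqP E0; apply/eqP; rewrite -subr_eq0.
apply: contraTT isT => cc; move/eqP: v00; case.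
have := congr1 ( *:%R ((c - c')^-1)%:A) E0.
by rewrite scaler0 scalerA -scalerAl mul1r scalerA mulVf // !scale1r.
Qed.

Lemma irr_mod_dim1 : mod_dim1 V.
Proof. by have [[v0 v00] _] := Virr; exists v0; apply: irr_cyclic. Qed.

Lemma irr_char_mod (psi : {rmorphism A -> C}) : (forall c, psi c%:A = c) ->
  (forall a (v : V), a *: v = (psi a)%:A *: v) -> mod_iso V (char_mod psi).
Proof.
move=> psiC psiV; have [[v0 v00] _] := Virr.
have ex w : exists c : C, w = c%:A *: v0.
  by have [c [Ec _]] := irr_cyclic v00 w; exists c.
pose f (w : V) : char_mod psi := sval (cid (ex w)).
have fE w : w = (f w : C)%:A *: v0 by rewrite /f; case: cid.
have inj (c c' : C) : c%:A *: v0 = c'%:A *: v0 -> c = c'.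
  by move=> E; have [x [_ xP]] := irr_cyclic v00 (c%:A *: v0); rewrite -(xP _ erefl) -(xP _ E).
have flin : linear f.
  move=> a u v; apply: inj; rewrite -fE [in LHS](fE u) [in LHS](fE v) char_modE psiV.
  by rewrite scalerA -scalerDl -scalerAl mul1r scalerA -scalerDl.
pose fL : {linear V -> char_mod psi} := HB.pack f (GRing.isLinear.Build _ _ _ _ f flin).
exists fL; exists (fun c : char_mod psi => (c : C)%:A *: v0) => [v | c].
  exact: esym (fE v).
by apply: inj; rewrite -fE.
Qed.
End Irreducible.
End CommutativeIrreducible.

(** * Roots of Dickson polynomials *)

Section DicksonRoots.

(** Binet's formula: a and b are the roots of the characteristic polynomial X ^ 2 - (a + b) X + ab
    of the recurrence. *)
Lemma dickson_eval (C : comNzRingType) (a b : C) l :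
  (dickson (a * b) l).[a + b] * (a - b) = a ^+ l - b ^+ l.
Proof.
elim/ltn_ind: l => -[|[|l]] IH; first by rewrite horner0 mul0r subrr.
  by rewrite hornerC mul1r.
rewrite dicksonS hornerD hornerN hornerM hornerX hornerZ mulrBl -!mulrA !IH //.
rewrite !exprS; ring.
Qed.

Lemma dickson_eval2 (C : comNzRingType) l : (dickson (1 : C) l).[2] = l%:R.
Proof.
elim/ltn_ind: l => -[|[|l]] IH; first by rewrite horner0.
  by rewrite hornerC.
rewrite dicksonS hornerD hornerN hornerM hornerX hornerZ !IH //.
rewrite -[l.+2]addn2 -[l.+1]addn1 !natrD; ring.
Qed.

Lemma dickson_monic (C : idomainType) (t : C) l :
  dickson t l.+1 \is monic /\ size (dickson t l.+1) = l.+1.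
Proof.
suff [] : [/\ dickson t l.+1 \is monic, size (dickson t l.+1) = l.+1 & size (dickson t l) = l].
  by [].
elim: l => [|l [mS sS s0]]; first by rewrite monic1 size_poly1 size_poly0.
have sX : size ('X * dickson t l.+1) = l.+2.
  by rewrite mulrC size_mulX ?sS // -size_poly_eq0 sS.
have lt : (size (- (t *: dickson t l))%R < size ('X * dickson t l.+1)%R)%N.
  by rewrite sX size_polyN (leq_ltn_trans (size_scale_leq _ _)) // s0 ltnW.
rewrite dicksonS; split=> //; last by rewrite size_polyDl.
by rewrite monicE lead_coefDl // lead_coefM lead_coefX mul1r (eqP mS).
Qed.

Variables (C : closedFieldType) (d : nat).
Hypotheses (d0 : (1 < d)%N) (dC : (2 * d)%:R != 0 :> C).

(** With t = u ^ 2 and x a primitive 2d-th root of unity, the roots are u (x ^ k + x ^ (- k)) for 0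
    < k < d, by [dickson_eval] at a = u x ^ k and b = u x ^ (- k): a ^ d = b ^ d although a and b
    differ. *)
Lemma dickson_roots (t : C) : t != 0 ->
  exists rs, [/\ uniq rs, size rs = d.-1 & dickson t d = \prod_(r <- rs) ('X - r%:P)].
Proof.
move=> t0.
have [u tu] : exists u : C, t = u * u.
  have /closed_rootP[u] : size ('X^2 - t%:P) != 1 by rewrite size_XnsubC.
  by rewrite /root !hornerE subr_eq0 => /eqP ut; exists u; rewrite -expr2 ut.
have u0 : u != 0 by apply: contraNneq t0 => u0; rewrite tu u0 mul0r.
have dd0 : (0 < 2 * d)%N by rewrite muln_gt0 /= ltnW.
have [x xP] := closed_prim_root dd0 dC.
have x0 : x != 0 by apply: prim_root_neq0 dd0 xP.
have xx k : x ^+ k * x ^- k = 1 by rewrite divff // expf_neq0.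
pose f k := u * x ^+ k + u * x ^- k.
have ch_d : d.-1.+1 = d by rewrite prednK // ltnW.
exists [seq f k | k <- iota 1 d.-1].
have x_neq j : (0 < j < 2 * d)%N -> x ^+ j != 1.
  by case/andP=> j0 jd; rewrite -(prim_order_dvd xP) gtnNdvd.
have un : uniq [seq f k | k <- iota 1 d.-1].
  rewrite map_inj_in_uniq ?iota_uniq // => j k.
  rewrite !mem_iota add1n ch_d => /andP[j0 jd] /andP[k0 kd].
  rewrite /f -!mulrDr => /(mulfI u0) E.
  have Aj : x ^+ j != 0 by rewrite expf_neq0.
  have Ak : x ^+ k != 0 by rewrite expf_neq0.
  (* The difference of two candidate roots, divided by u, factors; the second factor is nonzero
     since 0 < j + k < 2d. *)
  have /eqP : (x ^+ j - x ^+ k) * (1 - (x ^+ j * x ^+ k)^-1) = 0.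
    transitivity ((x ^+ j + x ^- j) - (x ^+ k + x ^- k)); last by rewrite E subrr.
    by field; rewrite Aj Ak.
  have lt2 i : (i < d -> i < 2 * d)%N by move=> id; rewrite mul2n -addnn ltn_addr.
  rewrite mulf_eq0 !subr_eq0 => /orP[].
    by rewrite (eq_prim_root_expr xP) !modn_small ?lt2 // => /eqP.
  rewrite eq_sym invr_eq1 -exprD => /eqP jk1; have := x_neq (j + k)%N.
  rewrite jk1 eqxx => /(_ _)/negP; case=> //.
  by rewrite addn_gt0 j0 mul2n -addnn -addSn leq_add // ltnW.
split=> //; first by rewrite size_map size_iota.
have [mD sD] := dickson_monic t d.-1; rewrite ch_d in mD sD.
rewrite [LHS](all_roots_prod_XsubC (rs := [seq f k | k <- iota 1 d.-1])).
- by rewrite (monicP mD) scale1r.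
- by rewrite sD size_map size_iota.
- apply/allP=> _ /mapP[k + ->]; rewrite mem_iota add1n ch_d => /andP[k0 kd].
  have := dickson_eval (u * x ^+ k) (u * x ^- k) d.
  have -> : u * x ^+ k * (u * x ^- k) = t by rewrite mulrACA xx mulr1 tu.
  rewrite !exprMn.
  (* Both sides are inverse to x ^ (k d), because x ^ (2 k d) = 1. *)
  have -> : x ^- k ^+ d = x ^+ k ^+ d.
    apply: (mulfI (expf_neq0 d (expf_neq0 k x0))); rewrite -exprMn xx expr1n -expr2.
    by rewrite -!exprM [(d * 2)%N]mulnC mulnC exprM (prim_expr_order xP) expr1n.
  rewrite subrr => /eqP; rewrite mulf_eq0 -mulrBr mulf_eq0 (negPf u0) /=.
  case/orP=> // /eqP Ek; have := x_neq (k + k)%N.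
  rewrite exprD -[X in X * _ == _](subrK (x ^- k)) Ek add0r mulVf ?expf_neq0 // eqxx.
  move=> /(_ _)/negP; case=> //.
  by rewrite addn_gt0 k0 mul2n -addnn -addSn leq_add // ltnW.
- by rewrite uniq_rootsE.
Qed.

(** By [dickson_eval] at a = 1 and b = t, the value 1 + t is already a root of [dickson t d] if t
    differs from 1; at t = 1 the value there is d, which is nonzero. [rs'] lists the roots with
    multiplicity, [rs] without. *)
Lemma dickson_top_roots (t : C) : t ^+ d = 1 ->
  exists rs rs', [/\ uniq rs, size rs = (d.-1 + (t == 1%R))%N, rs' =i rs &
    ('X - (1 + t)%:P) * dickson t d = \prod_(r <- rs') ('X - r%:P)].
Proof.
move=> td.
have t0 : t != 0.
  by apply/eqP=> t0; move/eqP: td; rewrite t0 expr0n gtn_eqF ?(ltnW d0) // eq_sym oner_eq0.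
have [rs [un szr E]] := dickson_roots t0.
have mem1 : ((1 + t) \in rs) = (t != 1).
  rewrite -root_prod_XsubC -E /root; have [-> | t1] := eqVneq t 1.
    rewrite dickson_eval2; apply: contraNF dC => /eqP dC0.
    by rewrite natrM dC0 mulr0.
  have := dickson_eval 1 t d; rewrite mul1r expr1n td subrr => /eqP.
  by rewrite mulf_eq0 subr_eq0 [1 == t]eq_sym (negPf t1) orbF.
have [t1 | t1] := eqVneq t 1.
- exists (1 + t :: rs), (1 + t :: rs); split=> //; last by rewrite big_cons E.
  + by rewrite /= mem1 t1 eqxx.
  + by rewrite /= szr addn1.
- exists rs, (1 + t :: rs); split=> //; last by rewrite big_cons E.
  + by rewrite addn0.
  + by move=> r; rewrite inE; case: eqP => // ->; rewrite mem1.
Qed.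
End DicksonRoots.

(** * Irreducible modules of the Green algebra *)

Section GreenAlgebraModules.
Variables (C K : closedFieldType) (D : taft_datum K).
Local Notation q := (tq D).
Local Notation n := (tn D).
Local Notation d := (td D).
Local Notation A := (green_algebra C D).

Variables (w : K) (s : nat).
Hypotheses (wP : n.-primitive_root w) (ws : w ^+ s = q^-1).
Local Notation U l k := (gcl (unis wP ws l k)).
Local Notation ga x := (ga_tens (1 : C) x).

Lemma ga_mulC (a b : A) : a * b = b * a.
Proof.
elim/tens_ind: a => [c x||a a' IH IH'|a IH].
- elim/tens_ind: b => [c' x'||b b' IH IH'|b IH].
  + by rewrite !tmk_mul (green_mulC wP ws x x'); congr tmk; apply: (@mulrC C).
  + by rewrite mul0r mulr0.
  + by rewrite mulrDr mulrDl IH IH'.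
  + by rewrite mulrN mulNr IH.
- by rewrite mul0r mulr0.
- by rewrite mulrDr mulrDl IH IH'.
- by rewrite mulrN mulNr IH.
Qed.

Lemma gaD x y : ga (x + y) = ga x + ga y :> A.
Proof. exact: tmkDr. Qed.

Lemma gaN x : ga (- x) = - ga x :> A.
Proof. by apply: (addIr (ga x)); rewrite -gaD !addNr; apply: tmk0r. Qed.

Lemma gaM x y : ga (x * y) = ga x * ga y :> A.
Proof. by rewrite [RHS]tmk_mul; congr tmk; rewrite [RHS]mulr1. Qed.

Lemma gaX x k : ga (x ^+ k) = ga x ^+ k :> A.
Proof. by elim: k => [|k IH]; rewrite ?expr0 // !exprS gaM IH. Qed.

Lemma ga_tensE c x : ga_tens c x = c *: (ga x : A).
Proof. by rewrite -[RHS]/(ga_scale c (ga x)) ga_scale_tens mulr1. Qed.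

Section IrreducibleGreen.
Variable V : lmodType A.
Hypothesis Virr : irreducible_mod V.

Lemma green_scalar_ext (psi : {rmorphism A -> C}) : (forall c, psi c%:A = c) ->
    (forall v : V, ga (U 1 1) *: v = (psi (ga (U 1 1)))%:A *: v) ->
    (forall v : V, ga (U 2 0) *: v = (psi (ga (U 2 0)))%:A *: v) ->
  forall a (v : V), a *: v = (psi a)%:A *: v.
Proof.
move=> psiC PY PZ.
have P x : forall v : V, ga x *: v = (psi (ga x))%:A *: v.
  apply: (@green_gen_ind _ _ _ _ wP ws (fun x => forall v : V, ga x *: v = (psi (ga x))%:A *: v))
    => // {x} [x y Px Py v|x Px v|x y Px Py v].
  - by rewrite gaD rmorphD !scalerDl Px Py.
  - by rewrite gaN rmorphN !scaleNr Px.
  - by rewrite gaM rmorphM -scalerA Py Px scalerA -scalerAl mul1r scalerA.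
move=> a; elim/tens_ind: a => [c x||a b Pa Pb|a Pa] v.
- have E : tmk c x = c%:A * ga x :> A by rewrite -scalerAl mul1r -ga_tensE.
  by rewrite E rmorphM psiC -[LHS]scalerA P scalerA -scalerAl mul1r scalerA.
- by rewrite rmorph0 !scale0r.
- by rewrite rmorphD !scalerDl Pa Pb.
- by rewrite rmorphN !scaleNr Pa.
Qed.

Lemma irr_root (a : A) (rs : seq C) (p : {poly C}) :
    p = \prod_(r <- rs) ('X - r%:P) -> (forall v : V, horner_alg a p *: v = 0) ->
  exists2 c, c \in rs & forall v : V, a *: v = c%:A *: v.
Proof.
move=> -> pV; apply: (irr_eigenvalue Virr ga_mulC) => v; rewrite -[RHS](pV v).
rewrite rmorph_prod; congr (_ *: _); apply: eq_bigr => c _.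
by rewrite rmorphB /= horner_algX horner_algC.
Qed.

Lemma irr_root_Y (zeta : C) : n.-primitive_root zeta ->
  exists j : 'I_n, forall v : V, ga (U 1 1) *: v = (zeta ^+ j)%:A *: v.
Proof.
move=> zP; have [|v|c] := @irr_root (ga (U 1 1)) [seq zeta ^+ j | j <- iota 0 n] ('X^n - 1).
- by rewrite big_map -(factor_Xn_sub_1 zP) /index_iota subn0.
- by rewrite rmorphB rmorph1 rmorphXn /= horner_algX -gaX gcl_unis1_Xn subrr scale0r.
case/mapP=> j; rewrite mem_iota /= => jn -> cV.
by exists (Ordinal jn).
Qed.

(** Where Y acts by y, the class of M(l, 0) acts as [dickson (y ^+ s) l] evaluated at Z, and
    [gcl_unis2_mul_top] becomes the stated relation. *)
Lemma irr_dickson (y : C) : (forall v : V, ga (U 1 1) *: v = y%:A *: v) ->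
  forall v : V, horner_alg (ga (U 2 0))
    (('X - (1 + y ^+ s)%:P) * dickson (y ^+ s) d) *: v = 0.
Proof.
move=> yV; have yXV k (v : V) : ga (U 1 k) *: v = (y ^+ k)%:A *: v.
  rewrite gcl_unis1 gaX; elim: k v => [|k IH] v; first by rewrite !expr0 !scale1r.
  by rewrite !exprS -scalerA IH yV scalerA -scalerAl mul1r scalerA.
have d0 : (0 < d)%N := ltnW (td_gt1 D).
have UV l : (l <= d)%N -> forall v : V,
    ga (U l 0) *: v = horner_alg (ga (U 2 0)) (dickson (y ^+ s) l) *: v.
  elim/ltn_ind: l => -[|[|l]] IH ld v.
  - by rewrite gcl_unis0 rmorph0 scale0r [ga_tens _ _]tmk0r scale0r.
  - by rewrite gcl_unis1 expr0 rmorph1.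
  (* The case l = 0 is separate because [gcl_unis1_mul] asks for a positive length. *)
  - have E : U l.+2 0 = U 2 0 * U l.+1 0 - U 1 s * U l 0.
      rewrite gcl_unis2_mul //=; case: l {IH} ld => [|l] ld.
        by rewrite !gcl_unis0 mulr0 subr0 addr0.
      have ld1 : (l.+1 <= d)%N by do 2!apply: ltnW.
      by rewrite gcl_unis1_mul //= addn0 add0n addrK.
    rewrite dicksonS -mul_polyC rmorphB !rmorphM /= horner_algX horner_algC E gaD gaN !gaM.
    rewrite !scalerDl !scaleNr -!scalerA.
    rewrite (IH l.+1 (ltnSn _) (ltnW ld)) (IH l (leqW (ltnSn _)) (ltnW (ltnW ld))).
    by rewrite yXV; congr (_ - _); rewrite [RHS]scalerA.
move=> v; rewrite rmorphM -scalerA -UV // rmorphB /= horner_algX horner_algC scalerBl.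
rewrite scalerA -gaM gcl_unis2_mul_top gaD scalerDl add0n.
have -> : U d s = U 1 s * U d 0 by rewrite gcl_unis1_mul ?addn0 // d0 leqnn.
rewrite gaM -[(ga _ * _) *: _]scalerA yXV [(1 + _)%:A]scalerDl [X in _ - X]scalerDl.
by rewrite !scale1r subrr.
Qed.
End IrreducibleGreen.
End GreenAlgebraModules.

(** Both 0 and n are multiples of d, so counting from 0 to n - 1 agrees with counting from 1 to
    n. *)
Lemma sum_dvdn n d : (0 < n)%N -> (d %| n)%N -> (\sum_(j < n) (d %| j) = n %/ d)%N.
Proof.
move=> n0 dn; rewrite divn_count_dvd -(big_mkord xpredT (fun j => d %| j : nat)%N).
by rewrite big_ltn // dvdn0 big_nat_recr //= dn addnC.
Qed.

(** * Counting the characters *)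

Section Classification.
Variables (C K : closedFieldType) (D : taft_datum K).
Hypotheses (charC : [pchar C] =i pred0) (charK : [pchar K] =i pred0).
Local Notation n := (tn D).
Local Notation d := (td D).
Local Notation A := (green_algebra C D).

Lemma num_irreducible_green :
  num_irreducible A (n * d - n + n %/ d) /\
  (forall V : lmodType A, irreducible_mod V -> mod_dim1 V).
Proof.
have n0 : (0 < n)%N := ltnW (tn_gt1 D); have d1 := td_gt1 D.
have nK : n%:R != 0 :> K by rewrite ((pcharf0P K).1 charK) -lt0n.
have nC : n%:R != 0 :> C by rewrite ((pcharf0P C).1 charC) -lt0n.
have dC : (2 * d)%:R != 0 :> C by rewrite ((pcharf0P C).1 charC) -lt0n muln_gt0 /= ltnW.
have [w wP] := closed_prim_root n0 nK; have [zeta zP] := closed_prim_root n0 nC.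
have [s ws] : exists s, w ^+ s = (tq D)^-1.
  apply: (prim_root_inv n0 wP); have /dvdnP[m ->] := td_dvd D.
  by rewrite mulnC exprM (prim_expr_order (tq_prim D)) expr1n.
pose t (j : 'I_n) := (zeta ^+ j) ^+ s.
(* [zeta] and [w] have the same order n, so powers of [zeta] are compared with 1 through [w], where
   w ^ s = 1/q. *)
have ts j : t j ^+ d = 1.
  rewrite /t -!exprM; apply/eqP; rewrite -(prim_order_dvd zP).
  rewrite dvdn_mull // (prim_order_dvd wP) exprM ws exprVn.
  by rewrite (prim_expr_order (tq_prim D)) invr1.
have t1 j : (t j == 1) = (d %| j)%N.
  rewrite /t -exprM -(prim_order_dvd zP) (prim_order_dvd wP) mulnC exprM ws exprVn.
  by rewrite invr_eq1 -(prim_order_dvd (tq_prim D)).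
have /fin_all_exists[rs rsP] j := dickson_top_roots d1 dC (ts j).
have {rsP} /fin_all_exists[rs' rsP] j := rsP j.
(* The pairs (y, z) of scalars for Y and Z, with y = zeta ^ j encoded by its exponent j. *)
pose pts := [seq (j, z) | j <- enum 'I_n, z <- rs j].
have pts_uniq : uniq pts.
  apply: allpairs_uniq_dep => [|j _|[j z] [j' z'] _ _ [-> ->]] //; first exact: enum_uniq.
  by have [] := rsP j.
have pts_size : size pts = (n * d - n + n %/ d)%N.
  rewrite size_allpairs_dep sumnE big_map big_enum /= -(sum_dvdn n0 (td_dvd D)).
  under eq_bigr => j _ do (have [_ -> _ _] := rsP j; rewrite t1).
  by rewrite big_split /= sum_nat_const card_ord -subn1 mulnBr muln1.
rewrite -pts_size.
pose p0 : 'I_n * C := (Ordinal n0, 0).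
pose p (i : 'I_(size pts)) := nth p0 pts i.
pose Y : A := ga_tens 1 (gcl (unis wP ws 1 1)).
pose Z : A := ga_tens 1 (gcl (unis wP ws 2 0)).
have /fin_all_exists[psi psiP] (i : 'I_(size pts)) : exists psi : {rmorphism A -> C},
    [/\ forall c, psi c%:A = c, psi Y = zeta ^+ (p i).1 & psi Z = (p i).2].
  have /allpairsPdep[j [z [_ zj pE]]] : p i \in pts by apply: mem_nth.
  have [_ _ rsE E] := rsP j.
  have yn : (zeta ^+ j) ^+ n = 1 by rewrite exprAC (prim_expr_order zP) expr1n.
  have top : z * (dickson (t j) d).[z] = (1 + t j) * (dickson (t j) d).[z].
    apply/eqP; rewrite -subr_eq0 -mulrBl; move: zj; rewrite -rsE -root_prod_XsubC -E /root.
    by rewrite hornerM hornerXsubC.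
  have [psi [psiB psiM psiC psiY psiZ]] := green_algebra_char wP ws yn top.
  pose psiR : {rmorphism A -> C} := HB.pack psi
    (GRing.isZmodMorphism.Build _ _ psi psiB) (GRing.isMonoidMorphism.Build _ _ psi psiM).
  exists psiR.
  by rewrite pE.
have classify (V : lmodType A) : irreducible_mod V ->
    exists i, forall a (v : V), a *: v = (psi i a)%:A *: v.
  move=> Virr; have [j Yj] := irr_root_Y wP ws Virr zP.
  have [_ _ rsE E] := rsP j.
  have [z zj Zz] := irr_root wP ws Virr E (irr_dickson Yj).
  have zP' : (j, z) \in pts by apply: allpairs_f_dep; rewrite ?mem_enum // -rsE.
  have ip : (index (j, z) pts < size pts)%N by rewrite index_mem.
  exists (Ordinal ip); have [psiC psiY psiZ] := psiP (Ordinal ip).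
  apply: (green_scalar_ext (wP := wP) (ws := ws) psiC) => v.
    by rewrite psiY /p /= nth_index.
  by rewrite psiZ /p /= nth_index.
split; last first.
  move=> V Virr; apply: (irr_mod_dim1 Virr) => a.
  by have [i iP] := classify V Virr; exists (psi i a).
exists (fun i => char_mod (psi i)); split=> [i|i i'|V Virr].
- by have [psiC _ _] := psiP i; apply: char_mod_irr.
- have [psiC psiY psiZ] := psiP i; have [psiC' psiY' psiZ'] := psiP i'.
  move=> /(char_mod_iso psiC psiC') E.
  have := E Z; rewrite psiZ psiZ' => Ez.
  have := E Y; rewrite psiY psiY' => /eqP.
  rewrite (eq_prim_root_expr zP) !modn_small // => /eqP/val_inj Ej.
  have Ep : p i = p i' by apply/eqP; rewrite -pair_eqE /= Ej Ez !eqxx.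
  by apply: val_inj; move/eqP: Ep; rewrite nth_uniq // => /eqP.
- have [i iP] := classify V Virr; exists i.
  by have [psiC _ _] := psiP i; apply: irr_char_mod => // a; exists (psi i a).
Qed.
End Classification.

Theorem theorem5p1 (R : realType) (K : closedFieldType)
    (charK : [pchar K] =i pred0) (n d : nat) (q : K)
    (hn : (1 < n)%N) (hd : (1 < d)%N) (hdn : (d %| n)%N)
    (hq : d.-primitive_root q) :
  num_irreducible (green_algebra R[i] (TaftDatum hn hd hdn hq))
    (n * d - n + n %/ d) /\
  (forall V : lmodType (green_algebra R[i] (TaftDatum hn hd hdn hq)),
     irreducible_mod V -> mod_dim1 V).
Proof.
exact: (@num_irreducible_green R[i] K (TaftDatum hn hd hdn hq) (Num.Theory.pchar_num _) charK).
Qed.
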